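(* Let $\mathbf H=(\underline H,\overline H,\tau)$ be a weak braided bimonad on a Cauchy complete category $\mathbb A$. The following are equivalent: (a) $\mathbf H$ is a weak braided Hopf monad (i.e. it has a weak antipode); (b) the functor $K_\omega:\mathbb A\to\mathbb A^{\overline H}_{\underline H}(\omega)$ admits both a left and a right adjoint, and the right adjoint is monadic; (c) the functor $K_\omega:\mathbb A\to\mathbb A^{\overline H}_{\underline H}(\omega)$ admits both a left and a right adjoint, and the left adjoint is comonadic; (d) the induced natural transformation $\gamma:H\otimes_{\underline H^{\bar\xi}}H\to\overline G$ is an isomorphism; (e) the induced natural transformation $\gamma':\overline T\to H\otimes^{\overline H_{\bar\xi}}H$ is an isomorphism. Moreover, if these equivalent conditions hold, then there is an equivalence of categories $\mathbb A_{\underline H^{\bar\xi}}\simeq\mathbb A^{\overline H}_{\underline H}(\omega)$.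
   Context: Conventions. $\cdot$ is vertical composition of natural transformations; juxtaposition is composition of functors and whiskering ($Hm$, $mH$, ...), and $\varphi\psi$ is the horizontal composite of $\varphi,\psi$. $1$ is the identity functor or transformation. A category is Cauchy complete if every idempotent splits. $\mathbb A_{\underline H}$ is the Eilenberg–Moore category of modules of a monad $\underline H$, $\mathbb A^{\overline H}$ the category of comodules of a comonad $\overline H$. A right adjoint is monadic (a left adjoint is comonadic) if the comparison functor to the modules (comodules) of the induced monad (comonad) is an equivalence. Weak YB-pair. For $H:\mathbb A\to\mathbb A$, natural transformations $\tau,\tau':HH\to HH$ form a weak YB-pair if $\tau\tau'\tau=\tau$, $\tau'\tau\tau'=\tau'$, $\tau\cdot\tau'=\tau'\cdot\tau$; $H\tau\cdot\tau H\cdot H\tau=\tau H\cdot H\tau\cdot\tau H$ and the same for $\tau'$; and, with $\nabla:=\tau\cdot\tau'$, $\tau H\cdot H\nabla=H\nabla\cdot\tau H$, $H\tau\cdot\nabla H=\nabla H\cdot H\tau$, and both equations with $\tau'$ in place of $\tau$. Weak braided bimonad. Let $\underline H=(H,m,e)$ be a monad and $\overline H=(H,\delta,\varepsilon)$ a comonad on $\mathbb A$ with the same endofunctor $H$, and $\tau,\tau'$ a weak YB-pair, $\nabla=\tau\cdot\tau'$. $\mathbf H=(\underline H,\overline H,\tau)$ is a weak braided bimonad if (1) $m\cdot\nabla=m$, $\nabla\cdot\delta=\delta$; (2) $\nabla\cdot He=\tau\cdot eH$, $H\varepsilon\cdot\nabla=\varepsilon H\cdot\tau$, $\nabla\cdot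 eH=\tau\cdot He$, $\varepsilon H\cdot\nabla=H\varepsilon\cdot\tau$; (3) $\delta H\cdot\tau=H\tau\cdot\tau H\cdot H\delta$, $\tau\cdot mH=Hm\cdot\tau H\cdot H\tau$; (4) $H\delta\cdot\tau=\tau H\cdot H\tau\cdot\delta H$, $\tau\cdot Hm=mH\cdot H\tau\cdot\tau H$; (5) $\delta\cdot m=mm\cdot H\tau H\cdot\delta\delta$; (6) $\varepsilon\varepsilon\cdot mm\cdot H\delta H=\varepsilon\cdot m\cdot mH=\varepsilon\varepsilon\cdot mm\cdot H\tau'H\cdot H\delta H$; (7) $HmH\cdot\delta\delta\cdot ee=\delta H\cdot\delta\cdot e=HmH\cdot H\tau'H\cdot\delta\delta\cdot ee$. Derived transformations. $\omega:=mH\cdot H\tau\cdot\delta H$, $\overline\omega:=Hm\cdot\tau H\cdot H\delta$ $(HH\to HH)$; $\xi:=\varepsilon H\cdot\omega\cdot eH$, $\bar\xi:=H\varepsilon\cdot\overline\omega\cdot He$ $(H\to H)$; $\sigma:=Hm\cdot\delta H$, $\bar\sigma:=mH\cdot H\delta$ $(HH\to HH)$. Weak antipode. For $\varphi,\varphi':H\to H$ put $\varphi*\varphi':=m\cdot\varphi\varphi'\cdot\delta$. A weak antipode is $S:H\to H$ with $1*S=\xi$, $S*1=\bar\xi$, $S*1*S=S$; a weak braided bimonad with a weak antipode is a weak braided Hopf monad. Mixed bimodules. $\mathbb A^{\overline H}_{\underline H}(\omega)$ has as objects triples $(a,h,\theta)$ with $(a,h)\in\mathbb A_{\underline H}$,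 $(a,\theta)\in\mathbb A^{\overline H}$ and $\theta\cdot h=H(h)\cdot\omega_a\cdot H(\theta)$; morphisms are morphisms of $\mathbb A$ that are both $\underline H$-module and $\overline H$-comodule morphisms. $K_\omega:\mathbb A\to\mathbb A^{\overline H}_{\underline H}(\omega)$, $a\mapsto(H(a),m_a,\delta_a)$. Monad and comonad $H^{\bar\xi}$. $\bar\xi$ is idempotent; let $\bar\xi=\iota^{\bar\xi}\cdot q^{\bar\xi}$, $q^{\bar\xi}\cdot\iota^{\bar\xi}=1$ be a splitting through $H^{\bar\xi}$. $\underline H^{\bar\xi}=(H^{\bar\xi},\,q^{\bar\xi}\cdot m\cdot(\iota^{\bar\xi}\iota^{\bar\xi}),\,q^{\bar\xi}\cdot e)$ is a monad and $\overline H_{\bar\xi}=(H^{\bar\xi},\,(q^{\bar\xi}q^{\bar\xi})\cdot\delta\cdot\iota^{\bar\xi},\,\varepsilon\cdot\iota^{\bar\xi})$ is a comonad. The functors $\overline G,\overline T$. $\kappa:=Hm\cdot\omega H\cdot eHH:HH\to HH$ and $\kappa':=\varepsilon HH\cdot\omega H\cdot H\delta:HH\to HH$ are idempotent; $\kappa=\bar i\cdot\bar p$, $\bar p\cdot\bar i=1$ is a splitting through $\overline G$, and $\kappa'=\bar i'\cdot\bar p'$, $\bar p'\cdot\bar i'=1$ a splitting through $\overline T$. (These are the underlying functors of the comonad $\mathbf G$ induced by $\omega$ on $\mathbb A_{\underline H}$ evaluated at free modules, respectively of the monad $\mathbf T$ induced by $\omega$ on $\mathbb A^{\overline H}$ evaluated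 at cofree comodules.) The transformation $\gamma$. Let $\rho_l:=m\cdot\iota^{\bar\xi}H:H^{\bar\xi}H\to H$ and $\rho_r:=m\cdot H\iota^{\bar\xi}:HH^{\bar\xi}\to H$. $l:HH\to H\otimes_{\underline H^{\bar\xi}}H$ denotes the coequaliser in $[\mathbb A,\mathbb A]$ of $\rho_rH,\,H\rho_l:HH^{\bar\xi}H\rightrightarrows HH$ (it exists). Then $\bar p\cdot\sigma$ coequalises this pair, and $\gamma$ is the unique natural transformation with $\gamma\cdot l=\bar p\cdot\sigma$. The transformation $\gamma'$. Let $\theta_l:=q^{\bar\xi}H\cdot\delta:H\to H^{\bar\xi}H$ and $\theta_r:=Hq^{\bar\xi}\cdot\delta:H\to HH^{\bar\xi}$. $\mathrm{can}:H\otimes^{\overline H_{\bar\xi}}H\to HH$ denotes the equaliser in $[\mathbb A,\mathbb A]$ of $\theta_rH,\,H\theta_l:HH\rightrightarrows HH^{\bar\xi}H$ (it exists). $\gamma'$ is the unique natural transformation with $\mathrm{can}\cdot\gamma'=\bar\sigma\cdot\bar i'$. *)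

(* Defs.v *)
(* Standard library only. Categories have Leibniz equality of morphisms;
   functional extensionality and proof irrelevance are used to identify natural
   transformations (resp. module and comodule morphisms) with equal underlying
   families (resp. morphisms).  An identity between natural transformations is
   written componentwise when strict associativity of functor composition would
   otherwise be needed: (F alpha)_a is [fmap F (alpha a)] and (alpha F)_a is
   [alpha (F a)]. *)
From Stdlib Require Import FunctionalExtensionality ProofIrrelevance.

#[local] Obligation Tactic := intros; simpl.

Set Implicit Arguments.
Unset Strict Implicit.
Unset Printing Implicit Defensive.

Declare Scope cat_scope.
Delimit Scope cat_scope with cat.
Local Open Scope cat_scope.

Reserved Notation "g ∘ f" (at level 40, left associativity).
Reserved Notation "G ⊙ F" (at level 40, left associativity).
Reserved Notation "α ⋆ β" (at level 40, left associativity).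

Record Category : Type := {
  Obj :> Type;
  Hom : Obj -> Obj -> Type;
  idm : forall a : Obj, Hom a a;
  comp : forall a b c : Obj, Hom b c -> Hom a b -> Hom a c;
  comp_idl : forall (a b : Obj) (f : Hom a b), comp (idm b) f = f;
  comp_idr : forall (a b : Obj) (f : Hom a b), comp f (idm a) = f;
  comp_assoc : forall (a b c d : Obj) (h : Hom c d) (g : Hom b c) (f : Hom a b),
    comp h (comp g f) = comp (comp h g) f
}.
Arguments Hom {c} _ _ : rename.
Arguments idm {c} a : rename.
Arguments comp {c a b c0} _ _ : rename.
Arguments comp_idl {c a b} f : rename.
Arguments comp_idr {c a b} f : rename.
Arguments comp_assoc {c a b c0 d} h g f : rename.
Notation "g ∘ f" := (comp g f) : cat_scope.

Definition IsIso (C : Category) (a b : C) (f : Hom a b) : Prop :=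
  exists g : Hom b a, g ∘ f = idm a /\ f ∘ g = idm b.

Definition Isomorphic (C : Category) (a b : C) : Prop :=
  exists f : Hom a b, IsIso f.

Record Splitting (C : Category) (a : C) (e : Hom a a) : Type := {
  split_obj : C;
  split_incl : Hom split_obj a;
  split_proj : Hom a split_obj;
  split_incl_proj : split_incl ∘ split_proj = e;
  split_proj_incl : split_proj ∘ split_incl = idm split_obj
}.

Definition CauchyComplete (C : Category) : Prop :=
  forall (a : C) (e : Hom a a), e ∘ e = e -> inhabited (Splitting e).

Record Coequalizer (C : Category) (a b : C) (f g : Hom a b) : Type := {
  coeq_obj : C;
  coeq_arr : Hom b coeq_obj;
  coeq_eq : coeq_arr ∘ f = coeq_arr ∘ g;
  coeq_univ : forall (c : C) (k : Hom b c), k ∘ f = k ∘ g ->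
    exists! u : Hom coeq_obj c, u ∘ coeq_arr = k
}.

Record Equalizer (C : Category) (a b : C) (f g : Hom a b) : Type := {
  eq_obj : C;
  eq_arr : Hom eq_obj a;
  eq_eq : f ∘ eq_arr = g ∘ eq_arr;
  eq_univ : forall (c : C) (k : Hom c a), f ∘ k = g ∘ k ->
    exists! u : Hom c eq_obj, eq_arr ∘ u = k
}.

Lemma paste (C : Category) (a b c a' b' c' : C)
  (x : Hom a a') (y : Hom b b') (z : Hom c c')
  (f : Hom a b) (g : Hom b c) (f' : Hom a' b') (g' : Hom b' c') :
  g' ∘ y = z ∘ g -> f' ∘ x = y ∘ f -> (g' ∘ f') ∘ x = z ∘ (g ∘ f).
Proof.
  intros Hg Hf. rewrite <- comp_assoc, Hf, comp_assoc, Hg.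
  symmetry. apply comp_assoc.
Qed.

Record Functor (C D : Category) : Type := {
  fobj :> C -> D;
  fmap : forall a b : C, Hom a b -> Hom (fobj a) (fobj b);
  fmap_id : forall a : C, fmap (idm a) = idm (fobj a);
  fmap_comp : forall (a b c : C) (g : Hom b c) (f : Hom a b),
    fmap (g ∘ f) = fmap g ∘ fmap f
}.
Arguments fmap {C D} f {a b} _ : rename.

Lemma fmap_square (C D : Category) (F : Functor C D) (a b c d : C)
  (f : Hom a b) (g : Hom b d) (h : Hom a c) (k : Hom c d) :
  g ∘ f = k ∘ h -> fmap F g ∘ fmap F f = fmap F k ∘ fmap F h.
Proof. intros E. rewrite <- !fmap_comp. now rewrite E. Qed.

Lemma fmap_retract (C D : Category) (F : Functor C D) (a b : C)
  (g : Hom b a) (f : Hom a b) : g ∘ f = idm a -> fmap F g ∘ fmap F f = idm _.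
Proof. intros E. rewrite <- fmap_comp, E. apply fmap_id. Qed.

Definition idF (C : Category) : Functor C C := {|
  fobj := fun a => a;
  fmap := fun a b f => f;
  fmap_id := fun a => eq_refl;
  fmap_comp := fun a b c g f => eq_refl
|}.

Program Definition compF (C D E : Category) (G : Functor D E) (F : Functor C D)
  : Functor C E := {|
  fobj := fun a => G (F a);
  fmap := fun a b f => fmap G (fmap F f)
|}.
Next Obligation. now rewrite !fmap_id. Qed.
Next Obligation. now rewrite !fmap_comp. Qed.
Notation "G ⊙ F" := (compF G F) : cat_scope.

Record NatTrans (C D : Category) (F G : Functor C D) : Type := {
  component :> forall a : C, Hom (F a) (G a);
  naturality : forall (a b : C) (f : Hom a b),
    component b ∘ fmap F f = fmap G f ∘ component a
}.
Arguments naturality {C D F G} n {a b} f : rename.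

Lemma NatTrans_ext (C D : Category) (F G : Functor C D) (α β : NatTrans F G) :
  (forall a, α a = β a) -> α = β.
Proof.
  destruct α as [α Hα], β as [β Hβ]; simpl; intros E.
  assert (E' : α = β) by (apply functional_extensionality_dep; exact E).
  subst β. f_equal. apply proof_irrelevance.
Qed.

Program Definition idN (C D : Category) (F : Functor C D) : NatTrans F F := {|
  component := fun a => idm (F a)
|}.
Next Obligation. now rewrite comp_idl, comp_idr. Qed.

Program Definition compN (C D : Category) (F G K : Functor C D)
  (β : NatTrans G K) (α : NatTrans F G) : NatTrans F K := {|
  component := fun a => β a ∘ α a
|}.
Next Obligation. exact (paste (naturality β f) (naturality α f)). Qed.

Program Definition FunCat (C D : Category) : Category := {|
  Obj := Functor C D;
  Hom := @NatTrans C D;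
  idm := @idN C D;
  comp := @compN C D
|}.
Next Obligation. apply NatTrans_ext; intros x; apply comp_idl. Qed.
Next Obligation. apply NatTrans_ext; intros x; apply comp_idr. Qed.
Next Obligation. apply NatTrans_ext; intros x; apply comp_assoc. Qed.

Program Definition whiskerL (C D E : Category) (K : Functor D E)
  (F G : Functor C D) (α : NatTrans F G) : NatTrans (K ⊙ F) (K ⊙ G) := {|
  component := fun a => fmap K (α a)
|}.
Next Obligation. exact (fmap_square K (naturality α f)). Qed.

Program Definition whiskerR (C D E : Category) (F G : Functor D E)
  (α : NatTrans F G) (K : Functor C D) : NatTrans (F ⊙ K) (G ⊙ K) := {|
  component := fun a => α (K a)
|}.
Next Obligation. exact (naturality α (fmap K f)). Qed.

Program Definition hcomp (C D E : Category) (F F' : Functor D E)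
  (G G' : Functor C D) (φ : NatTrans F F') (ψ : NatTrans G G')
  : NatTrans (F ⊙ G) (F' ⊙ G') := {|
  component := fun a => fmap F' (ψ a) ∘ φ (G a)
|}.
Next Obligation.
  exact (paste (fmap_square F' (naturality ψ f)) (naturality φ (fmap G f))).
Qed.
Notation "α ⋆ β" := (hcomp α β) : cat_scope.

(* The associator has identity components; it is only needed because functor
   composition is not strictly associative for Leibniz equality. *)
Program Definition assocF (B C D E : Category) (K : Functor D E)
  (G : Functor C D) (F : Functor B C)
  : NatTrans (K ⊙ (G ⊙ F)) ((K ⊙ G) ⊙ F) := {|
  component := fun a => idm (K (G (F a)))
|}.
Next Obligation. now rewrite comp_idl, comp_idr. Qed.

Program Definition assocF_inv (B C D E : Category) (K : Functor D E)
  (G : Functor C D) (F : Functor B C)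
  : NatTrans ((K ⊙ G) ⊙ F) (K ⊙ (G ⊙ F)) := {|
  component := fun a => idm (K (G (F a)))
|}.
Next Obligation. now rewrite comp_idl, comp_idr. Qed.

Definition IsEquivalence (C D : Category) (F : Functor C D) : Prop :=
  exists G : Functor D C,
    @Isomorphic (FunCat C C) (idF C) (G ⊙ F) /\
    @Isomorphic (FunCat D D) (F ⊙ G) (idF D).

Definition EquivalentCategories (C D : Category) : Prop :=
  exists F : Functor C D, IsEquivalence F.

Record IsMonad (C : Category) (T : Functor C C)
  (m : NatTrans (T ⊙ T) T) (e : NatTrans (idF C) T) : Prop := {
  monad_assoc : forall a, m a ∘ m (T a) = m a ∘ fmap T (m a);
  monad_unitl : forall a, m a ∘ e (T a) = idm (T a);
  monad_unitr : forall a, m a ∘ fmap T (e a) = idm (T a)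
}.

Record IsComonad (C : Category) (T : Functor C C)
  (δ : NatTrans T (T ⊙ T)) (ε : NatTrans T (idF C)) : Prop := {
  comonad_coassoc : forall a, δ (T a) ∘ δ a = fmap T (δ a) ∘ δ a;
  comonad_counitl : forall a, ε (T a) ∘ δ a = idm (T a);
  comonad_counitr : forall a, fmap T (ε a) ∘ δ a = idm (T a)
}.

Record Monad (C : Category) : Type := {
  monad_fun :> Functor C C;
  monad_mul : NatTrans (monad_fun ⊙ monad_fun) monad_fun;
  monad_unit : NatTrans (idF C) monad_fun;
  monad_law : IsMonad monad_mul monad_unit
}.

Record Comonad (C : Category) : Type := {
  comonad_fun :> Functor C C;
  comonad_comul : NatTrans comonad_fun (comonad_fun ⊙ comonad_fun);
  comonad_counit : NatTrans comonad_fun (idF C);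
  comonad_law : IsComonad comonad_comul comonad_counit
}.

Record IsModule (C : Category) (T : Monad C) (a : C) (h : Hom (T a) a)
  : Prop := {
  module_assoc : h ∘ fmap T h = h ∘ monad_mul T a;
  module_unit : h ∘ monad_unit T a = idm a
}.

Record IsComodule (C : Category) (T : Comonad C) (a : C) (θ : Hom a (T a))
  : Prop := {
  comodule_coassoc : fmap T θ ∘ θ = comonad_comul T a ∘ θ;
  comodule_counit : comonad_counit T a ∘ θ = idm a
}.

Definition IsModuleHom (C : Category) (T : Functor C C) (a b : C)
  (h : Hom (T a) a) (k : Hom (T b) b) (f : Hom a b) : Prop :=
  f ∘ h = k ∘ fmap T f.

Definition IsComoduleHom (C : Category) (T : Functor C C) (a b : C)
  (θ : Hom a (T a)) (ζ : Hom b (T b)) (f : Hom a b) : Prop :=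
  ζ ∘ f = fmap T f ∘ θ.

Lemma IsModuleHom_id (C : Category) (T : Functor C C) (a : C)
  (h : Hom (T a) a) : IsModuleHom h h (idm a).
Proof. unfold IsModuleHom. now rewrite fmap_id, comp_idl, comp_idr. Qed.

Lemma IsModuleHom_comp (C : Category) (T : Functor C C) (a b c : C)
  (h : Hom (T a) a) (k : Hom (T b) b) (l : Hom (T c) c)
  (g : Hom b c) (f : Hom a b) :
  IsModuleHom k l g -> IsModuleHom h k f -> IsModuleHom h l (g ∘ f).
Proof.
  unfold IsModuleHom. intros Hg Hf. rewrite fmap_comp. exact (paste Hg Hf).
Qed.

Lemma IsComoduleHom_id (C : Category) (T : Functor C C) (a : C)
  (θ : Hom a (T a)) : IsComoduleHom θ θ (idm a).
Proof. unfold IsComoduleHom. now rewrite fmap_id, comp_idl, comp_idr. Qed.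

Lemma IsComoduleHom_comp (C : Category) (T : Functor C C) (a b c : C)
  (θ : Hom a (T a)) (ζ : Hom b (T b)) (η : Hom c (T c))
  (g : Hom b c) (f : Hom a b) :
  IsComoduleHom ζ η g -> IsComoduleHom θ ζ f -> IsComoduleHom θ η (g ∘ f).
Proof.
  unfold IsComoduleHom. intros Hg Hf. rewrite fmap_comp.
  symmetry. exact (paste (eq_sym Hg) (eq_sym Hf)).
Qed.

Record Module (C : Category) (T : Monad C) : Type := {
  mod_obj : C;
  mod_act : Hom (T mod_obj) mod_obj;
  mod_law : IsModule mod_act
}.

Record ModuleHom (C : Category) (T : Monad C) (x y : Module T) : Type := {
  mod_hom : Hom (mod_obj x) (mod_obj y);
  mod_hom_law : IsModuleHom (mod_act x) (mod_act y) mod_hom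
}.

Lemma ModuleHom_ext (C : Category) (T : Monad C) (x y : Module T)
  (f g : ModuleHom x y) : mod_hom f = mod_hom g -> f = g.
Proof.
  destruct f as [f Hf], g as [g Hg]; simpl; intros E; subst g.
  f_equal. apply proof_irrelevance.
Qed.

Program Definition EM (C : Category) (T : Monad C) : Category := {|
  Obj := Module T;
  Hom := @ModuleHom C T;
  idm := fun x => Build_ModuleHom (IsModuleHom_id (mod_act x));
  comp := fun x y z g f =>
    Build_ModuleHom (IsModuleHom_comp (mod_hom_law g) (mod_hom_law f))
|}.
Next Obligation. apply ModuleHom_ext, comp_idl. Qed.
Next Obligation. apply ModuleHom_ext, comp_idr. Qed.
Next Obligation. apply ModuleHom_ext, comp_assoc. Qed.

Record Comodule (C : Category) (T : Comonad C) : Type := {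
  comod_obj : C;
  comod_coact : Hom comod_obj (T comod_obj);
  comod_law : IsComodule comod_coact
}.

Record ComoduleHom (C : Category) (T : Comonad C) (x y : Comodule T) : Type := {
  comod_hom : Hom (comod_obj x) (comod_obj y);
  comod_hom_law : IsComoduleHom (comod_coact x) (comod_coact y) comod_hom
}.

Lemma ComoduleHom_ext (C : Category) (T : Comonad C) (x y : Comodule T)
  (f g : ComoduleHom x y) : comod_hom f = comod_hom g -> f = g.
Proof.
  destruct f as [f Hf], g as [g Hg]; simpl; intros E; subst g.
  f_equal. apply proof_irrelevance.
Qed.

Program Definition CoEM (C : Category) (T : Comonad C) : Category := {|
  Obj := Comodule T;
  Hom := @ComoduleHom C T;
  idm := fun x => Build_ComoduleHom (IsComoduleHom_id (comod_coact x));
  comp := fun x y z g f =>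
    Build_ComoduleHom (IsComoduleHom_comp (comod_hom_law g) (comod_hom_law f))
|}.
Next Obligation. apply ComoduleHom_ext, comp_idl. Qed.
Next Obligation. apply ComoduleHom_ext, comp_idr. Qed.
Next Obligation. apply ComoduleHom_ext, comp_assoc. Qed.

Record Adjunction (C D : Category) (F : Functor C D) (U : Functor D C)
  : Type := {
  adj_unit : NatTrans (idF C) (U ⊙ F);
  adj_counit : NatTrans (F ⊙ U) (idF D);
  adj_triangle_left : forall c : C,
    adj_counit (F c) ∘ fmap F (adj_unit c) = idm (F c);
  adj_triangle_right : forall d : D,
    fmap U (adj_counit d) ∘ adj_unit (U d) = idm (U d)
}.

Section InducedMonad.
Context (C D : Category) (F : Functor C D) (U : Functor D C)
  (adj : Adjunction F U).

Program Definition adj_mul : NatTrans ((U ⊙ F) ⊙ (U ⊙ F)) (U ⊙ F) := {|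
  component := fun c => fmap U (adj_counit adj (F c))
|}.
Next Obligation.
  exact (fmap_square U (naturality (adj_counit adj) (fmap F f))).
Qed.

Lemma adj_isMonad : IsMonad adj_mul (adj_unit adj).
Proof.
  split; intros c; simpl.
  - exact (fmap_square U (eq_sym (naturality (adj_counit adj)
                                    (adj_counit adj (F c))))).
  - exact (adj_triangle_right adj (F c)).
  - exact (fmap_retract U (adj_triangle_left adj c)).
Qed.

Definition adj_monad : Monad C := Build_Monad adj_isMonad.

Program Definition adj_comul : NatTrans (F ⊙ U) ((F ⊙ U) ⊙ (F ⊙ U)) := {|
  component := fun d => fmap F (adj_unit adj (U d))
|}.
Next Obligation.
  exact (fmap_square F (naturality (adj_unit adj) (fmap U f))).
Qed.

Lemma adj_isComonad : IsComonad adj_comul (adj_counit adj).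
Proof.
  split; intros d; simpl.
  - exact (fmap_square F (naturality (adj_unit adj) (adj_unit adj (U d)))).
  - exact (adj_triangle_left adj (U d)).
  - exact (fmap_retract F (adj_triangle_right adj d)).
Qed.

Definition adj_comonad : Comonad D := Build_Comonad adj_isComonad.

Lemma monadic_comparison_isModule (d : D) :
  @IsModule C adj_monad (U d) (fmap U (adj_counit adj d)).
Proof.
  split; simpl.
  - exact (fmap_square U (naturality (adj_counit adj) (adj_counit adj d))).
  - apply adj_triangle_right.
Qed.

Lemma monadic_comparison_isModuleHom (d d' : D) (f : Hom d d') :
  @IsModuleHom C adj_monad _ _
    (fmap U (adj_counit adj d)) (fmap U (adj_counit adj d')) (fmap U f).
Proof.
  exact (fmap_square U (eq_sym (naturality (adj_counit adj) f))).
Qed.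

Program Definition monadic_comparison : Functor D (EM adj_monad) := {|
  fobj := fun d => Build_Module (monadic_comparison_isModule d);
  fmap := fun d d' f => @Build_ModuleHom C adj_monad
    (Build_Module (monadic_comparison_isModule d))
    (Build_Module (monadic_comparison_isModule d'))
    (fmap U f) (monadic_comparison_isModuleHom f)
|}.
Next Obligation. apply ModuleHom_ext; simpl. apply fmap_id. Qed.
Next Obligation. apply ModuleHom_ext; simpl. apply fmap_comp. Qed.

Lemma comonadic_comparison_isComodule (c : C) :
  @IsComodule D adj_comonad (F c) (fmap F (adj_unit adj c)).
Proof.
  split; simpl.
  - exact (fmap_square F (eq_sym (naturality (adj_unit adj)
                                    (adj_unit adj c)))).
  - apply adj_triangle_left.
Qed.

Lemma comonadic_comparison_isComoduleHom (c c' : C) (f : Hom c c') :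
  @IsComoduleHom D adj_comonad _ _
    (fmap F (adj_unit adj c)) (fmap F (adj_unit adj c')) (fmap F f).
Proof.
  exact (fmap_square F (naturality (adj_unit adj) f)).
Qed.

Program Definition comonadic_comparison : Functor C (CoEM adj_comonad) := {|
  fobj := fun c => Build_Comodule (comonadic_comparison_isComodule c);
  fmap := fun c c' f => @Build_ComoduleHom D adj_comonad
    (Build_Comodule (comonadic_comparison_isComodule c))
    (Build_Comodule (comonadic_comparison_isComodule c'))
    (fmap F f) (comonadic_comparison_isComoduleHom f)
|}.
Next Obligation. apply ComoduleHom_ext; simpl. apply fmap_id. Qed.
Next Obligation. apply ComoduleHom_ext; simpl. apply fmap_comp. Qed.

Definition Monadic : Prop := IsEquivalence monadic_comparison.
Definition Comonadic : Prop := IsEquivalence comonadic_comparison.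

End InducedMonad.

Record IsWeakYBPair (A : Category) (H : Functor A A)
  (τ τ' : NatTrans (H ⊙ H) (H ⊙ H)) : Prop := {
  yb_regular : forall a, τ a ∘ τ' a ∘ τ a = τ a;
  yb_regular' : forall a, τ' a ∘ τ a ∘ τ' a = τ' a;
  yb_comm : forall a, τ a ∘ τ' a = τ' a ∘ τ a;
  yb_braid : forall a,
    fmap H (τ a) ∘ τ (H a) ∘ fmap H (τ a) = τ (H a) ∘ fmap H (τ a) ∘ τ (H a);
  yb_braid' : forall a,
    fmap H (τ' a) ∘ τ' (H a) ∘ fmap H (τ' a)
      = τ' (H a) ∘ fmap H (τ' a) ∘ τ' (H a);
  yb_nablaR : forall a,
    τ (H a) ∘ fmap H (τ a ∘ τ' a) = fmap H (τ a ∘ τ' a) ∘ τ (H a);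
  yb_nablaL : forall a,
    fmap H (τ a) ∘ (τ (H a) ∘ τ' (H a)) = (τ (H a) ∘ τ' (H a)) ∘ fmap H (τ a);
  yb_nablaR' : forall a,
    τ' (H a) ∘ fmap H (τ a ∘ τ' a) = fmap H (τ a ∘ τ' a) ∘ τ' (H a);
  yb_nablaL' : forall a,
    fmap H (τ' a) ∘ (τ (H a) ∘ τ' (H a)) = (τ (H a) ∘ τ' (H a)) ∘ fmap H (τ' a)
}.

Record IsWeakBraidedBimonad (A : Category) (H : Functor A A)
  (m : NatTrans (H ⊙ H) H) (e : NatTrans (idF A) H)
  (δ : NatTrans H (H ⊙ H)) (ε : NatTrans H (idF A))
  (τ τ' : NatTrans (H ⊙ H) (H ⊙ H)) : Prop := {
  wbb_isMonad : IsMonad m e;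
  wbb_isComonad : IsComonad δ ε;
  wbb_isYB : IsWeakYBPair τ τ';
  wbb_m_nabla : forall a, m a ∘ (τ a ∘ τ' a) = m a;
  wbb_nabla_δ : forall a, (τ a ∘ τ' a) ∘ δ a = δ a;
  wbb_nabla_He : forall a, (τ a ∘ τ' a) ∘ fmap H (e a) = τ a ∘ e (H a);
  wbb_Hε_nabla : forall a, fmap H (ε a) ∘ (τ a ∘ τ' a) = ε (H a) ∘ τ a;
  wbb_nabla_eH : forall a, (τ a ∘ τ' a) ∘ e (H a) = τ a ∘ fmap H (e a);
  wbb_εH_nabla : forall a, ε (H a) ∘ (τ a ∘ τ' a) = fmap H (ε a) ∘ τ a;
  wbb_δH_τ : forall a,
    δ (H a) ∘ τ a = fmap H (τ a) ∘ τ (H a) ∘ fmap H (δ a);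
  wbb_τ_mH : forall a,
    τ a ∘ m (H a) = fmap H (m a) ∘ τ (H a) ∘ fmap H (τ a);
  wbb_Hδ_τ : forall a,
    fmap H (δ a) ∘ τ a = τ (H a) ∘ fmap H (τ a) ∘ δ (H a);
  wbb_τ_Hm : forall a,
    τ a ∘ fmap H (m a) = m (H a) ∘ fmap H (τ a) ∘ τ (H a);
  wbb_δ_m : forall a,
    δ a ∘ m a = (m ⋆ m) a ∘ fmap H (τ (H a)) ∘ (δ ⋆ δ) a;
  wbb_counit : forall a,
    (ε ⋆ ε) a ∘ (m ⋆ m) a ∘ fmap H (δ (H a)) = ε a ∘ m a ∘ m (H a);
  wbb_counit' : forall a,
    ε a ∘ m a ∘ m (H a)
      = (ε ⋆ ε) a ∘ (m ⋆ m) a ∘ fmap H (τ' (H a)) ∘ fmap H (δ (H a));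
  wbb_unit : forall a,
    fmap H (m (H a)) ∘ (δ ⋆ δ) a ∘ (e ⋆ e) a = δ (H a) ∘ δ a ∘ e a;
  wbb_unit' : forall a,
    δ (H a) ∘ δ a ∘ e a
      = fmap H (m (H a)) ∘ fmap H (τ' (H a)) ∘ (δ ⋆ δ) a ∘ (e ⋆ e) a
}.

(* τ' is the group inverse of τ, hence determined by τ; it is nevertheless
   recorded as data. *)
Record WeakBraidedBimonad (A : Category) : Type := {
  wbb_fun :> Functor A A;
  wbb_m : NatTrans (wbb_fun ⊙ wbb_fun) wbb_fun;
  wbb_e : NatTrans (idF A) wbb_fun;
  wbb_δ : NatTrans wbb_fun (wbb_fun ⊙ wbb_fun);
  wbb_ε : NatTrans wbb_fun (idF A);
  wbb_τ : NatTrans (wbb_fun ⊙ wbb_fun) (wbb_fun ⊙ wbb_fun);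
  wbb_τ' : NatTrans (wbb_fun ⊙ wbb_fun) (wbb_fun ⊙ wbb_fun);
  wbb_law : IsWeakBraidedBimonad wbb_m wbb_e wbb_δ wbb_ε wbb_τ wbb_τ'
}.

Section Derived.
Context (A : Category) (B : WeakBraidedBimonad A).
Local Notation H := (wbb_fun B).
Local Notation m := (wbb_m B).
Local Notation e := (wbb_e B).
Local Notation δ := (wbb_δ B).
Local Notation ε := (wbb_ε B).
Local Notation τ := (wbb_τ B).

Definition wbb_monad : Monad A := Build_Monad (wbb_isMonad (wbb_law B)).
Definition wbb_comonad : Comonad A := Build_Comonad (wbb_isComonad (wbb_law B)).

Program Definition omega : NatTrans (H ⊙ H) (H ⊙ H) := {|
  component := fun a => m (H a) ∘ fmap H (τ a) ∘ δ (H a)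
|}.
Next Obligation.
  exact (paste (paste (naturality m (fmap H f)) (fmap_square H (naturality τ f)))
    (naturality δ (fmap H f))).
Qed.

Program Definition omegabar : NatTrans (H ⊙ H) (H ⊙ H) := {|
  component := fun a => fmap H (m a) ∘ τ (H a) ∘ fmap H (δ a)
|}.
Next Obligation.
  exact (paste (paste (fmap_square H (naturality m f)) (naturality τ (fmap H f)))
    (fmap_square H (naturality δ f))).
Qed.

Program Definition xi : NatTrans H H := {|
  component := fun a => ε (H a) ∘ omega a ∘ e (H a)
|}.
Next Obligation.
  exact (paste (paste (naturality ε (fmap H f)) (naturality omega f))
    (naturality e (fmap H f))).
Qed.

Program Definition xibar : NatTrans H H := {|
  component := fun a => fmap H (ε a) ∘ omegabar a ∘ fmap H (e a)
|}.
Next Obligation.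
  exact (paste (paste (fmap_square H (naturality ε f)) (naturality omegabar f))
    (fmap_square H (naturality e f))).
Qed.

Program Definition sigma : NatTrans (H ⊙ H) (H ⊙ H) := {|
  component := fun a => fmap H (m a) ∘ δ (H a)
|}.
Next Obligation.
  exact (paste (fmap_square H (naturality m f)) (naturality δ (fmap H f))).
Qed.

Program Definition sigmabar : NatTrans (H ⊙ H) (H ⊙ H) := {|
  component := fun a => m (H a) ∘ fmap H (δ a)
|}.
Next Obligation.
  exact (paste (naturality m (fmap H f)) (fmap_square H (naturality δ f))).
Qed.

Program Definition kappa : NatTrans (H ⊙ H) (H ⊙ H) := {|
  component := fun a => fmap H (m a) ∘ omega (H a) ∘ e (H (H a))
|}.
Next Obligation.
  exact (paste (paste (fmap_square H (naturality m f))
                 (naturality omega (fmap H f)))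
    (naturality e (fmap H (fmap H f)))).
Qed.

Program Definition kappa' : NatTrans (H ⊙ H) (H ⊙ H) := {|
  component := fun a => ε (H (H a)) ∘ omega (H a) ∘ fmap H (δ a)
|}.
Next Obligation.
  exact (paste (paste (naturality ε (fmap H (fmap H f)))
                 (naturality omega (fmap H f)))
    (fmap_square H (naturality δ f))).
Qed.

Program Definition convolution (φ φ' : NatTrans H H) : NatTrans H H := {|
  component := fun a => m a ∘ (φ ⋆ φ') a ∘ δ a
|}.
Next Obligation.
  exact (paste (paste (naturality m f) (naturality (φ ⋆ φ') f))
    (naturality δ f)).
Qed.

Definition IsWeakAntipode (S : NatTrans H H) : Prop :=
  convolution (idN H) S = xi /\
  convolution S (idN H) = xibar /\
  convolution (convolution S (idN H)) S = S.

Definition IsWeakBraidedHopfMonad : Prop :=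
  exists S : NatTrans H H, IsWeakAntipode S.

Record MixedBimodule : Type := {
  mix_obj : A;
  mix_act : Hom (H mix_obj) mix_obj;
  mix_coact : Hom mix_obj (H mix_obj);
  mix_isModule : @IsModule A wbb_monad mix_obj mix_act;
  mix_isComodule : @IsComodule A wbb_comonad mix_obj mix_coact;
  mix_compat :
    mix_coact ∘ mix_act = fmap H mix_act ∘ omega mix_obj ∘ fmap H mix_coact
}.

Record MixedHom (x y : MixedBimodule) : Type := {
  mix_hom : Hom (mix_obj x) (mix_obj y);
  mix_hom_module : @IsModuleHom A H _ _ (mix_act x) (mix_act y) mix_hom;
  mix_hom_comodule : @IsComoduleHom A H _ _ (mix_coact x) (mix_coact y) mix_hom
}.

Lemma MixedHom_ext (x y : MixedBimodule) (f g : MixedHom x y) :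
  mix_hom f = mix_hom g -> f = g.
Proof.
  destruct f as [f Hf Hf'], g as [g Hg Hg']; simpl; intros E; subst g.
  f_equal; apply proof_irrelevance.
Qed.

Program Definition MixedBimod : Category := {|
  Obj := MixedBimodule;
  Hom := MixedHom;
  idm := fun x => Build_MixedHom
    (IsModuleHom_id (mix_act x)) (IsComoduleHom_id (mix_coact x));
  comp := fun x y z g f => Build_MixedHom
    (IsModuleHom_comp (mix_hom_module g) (mix_hom_module f))
    (IsComoduleHom_comp (mix_hom_comodule g) (mix_hom_comodule f))
|}.
Next Obligation. apply MixedHom_ext, comp_idl. Qed.
Next Obligation. apply MixedHom_ext, comp_idr. Qed.
Next Obligation. apply MixedHom_ext, comp_assoc. Qed.

Lemma K_isModule (a : A) : @IsModule A wbb_monad (H a) (m a).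
Proof.
  split; simpl.
  - symmetry. exact (monad_assoc (wbb_isMonad (wbb_law B)) a).
  - exact (monad_unitl (wbb_isMonad (wbb_law B)) a).
Qed.

Lemma K_isComodule (a : A) : @IsComodule A wbb_comonad (H a) (δ a).
Proof.
  split; simpl.
  - symmetry. exact (comonad_coassoc (wbb_isComonad (wbb_law B)) a).
  - exact (comonad_counitl (wbb_isComonad (wbb_law B)) a).
Qed.

Lemma K_compat (a : A) :
  δ a ∘ m a = fmap H (m a) ∘ omega (H a) ∘ fmap H (δ a).
Proof.
  rewrite (wbb_δ_m (wbb_law B) a); simpl. rewrite <- !comp_assoc.
  do 3 apply f_equal. exact (eq_sym (naturality δ (δ a))).
Qed.

Definition K_obj (a : A) : MixedBimodule :=
  Build_MixedBimodule (K_isModule a) (K_isComodule a) (K_compat a).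

Definition K_hom (a b : A) (f : Hom a b) : MixedHom (K_obj a) (K_obj b) :=
  @Build_MixedHom (K_obj a) (K_obj b) (fmap H f)
    (eq_sym (naturality m f)) (naturality δ f).

Program Definition K_omega : Functor A MixedBimod := {|
  fobj := K_obj;
  fmap := K_hom
|}.
Next Obligation. apply MixedHom_ext; simpl. apply fmap_id. Qed.
Next Obligation. apply MixedHom_ext; simpl. apply fmap_comp. Qed.

Section Xi.
Context (X : @Splitting (FunCat A A) H xibar).

Definition Hxi : Functor A A := split_obj X.
Definition xi_incl : NatTrans Hxi H := split_incl X.
Definition xi_proj : NatTrans H Hxi := split_proj X.

Definition xi_mul : NatTrans (Hxi ⊙ Hxi) Hxi :=
  compN xi_proj (compN m (xi_incl ⋆ xi_incl)).
Definition xi_unit : NatTrans (idF A) Hxi := compN xi_proj e.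

Definition rho_l : NatTrans (Hxi ⊙ H) H := compN m (whiskerR xi_incl H).
Definition rho_r : NatTrans (H ⊙ Hxi) H := compN m (whiskerL H xi_incl).

Definition rho_rH : NatTrans (H ⊙ (Hxi ⊙ H)) (H ⊙ H) :=
  compN (whiskerR rho_r H) (assocF H Hxi H).
Definition Hrho_l : NatTrans (H ⊙ (Hxi ⊙ H)) (H ⊙ H) := whiskerL H rho_l.

Definition theta_l : NatTrans H (Hxi ⊙ H) := compN (whiskerR xi_proj H) δ.
Definition theta_r : NatTrans H (H ⊙ Hxi) := compN (whiskerL H xi_proj) δ.

Definition theta_rH : NatTrans (H ⊙ H) (H ⊙ (Hxi ⊙ H)) :=
  compN (assocF_inv H Hxi H) (whiskerR theta_r H).
Definition Htheta_l : NatTrans (H ⊙ H) (H ⊙ (Hxi ⊙ H)) := whiskerL H theta_l.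

Definition TensorCoequalizer : Type :=
  @Coequalizer (FunCat A A) _ _ rho_rH Hrho_l.
Definition CotensorEqualizer : Type :=
  @Equalizer (FunCat A A) _ _ theta_rH Htheta_l.

(* Since the arrow l of a coequalizer is epi, there is at most one gamma for
   each l; and since coequalizers are unique up to a unique isomorphism, its
   invertibility does not depend on the choice of l.  Dually for gamma'. *)
Definition GammaIsIso (G : @Splitting (FunCat A A) (H ⊙ H) kappa) : Prop :=
  exists (l : TensorCoequalizer)
    (gamma : @Hom (FunCat A A) (coeq_obj l) (split_obj G)),
    gamma ∘ coeq_arr l = @comp (FunCat A A) _ _ _ (split_proj G) sigma /\
    IsIso gamma.

Definition GammaPrimeIsIso (T : @Splitting (FunCat A A) (H ⊙ H) kappa')
  : Prop :=
  exists (can : CotensorEqualizer)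
    (gamma' : @Hom (FunCat A A) (split_obj T) (eq_obj can)),
    eq_arr can ∘ gamma' = @comp (FunCat A A) _ _ _ sigmabar (split_incl T) /\
    IsIso gamma'.

End Xi.

End Derived.

(* Main.v *)
(* In Sweedler notation [xi x = ε(1_1 x) 1_2] and [xibar x = 1_1 ε(x 1_2)], and
   [sigma] is the Galois map [x ⊗ y ↦ x_1 ⊗ x_2 y].  The image of [xibar] is a
   separable Frobenius monad: the relative tensor product over it is split off
   [HH] by [balance : x ⊗ y ↦ x_1 ⊗ xibar(x_2) y], the functor [G] is split off
   by [kappa : x ⊗ y ↦ 1_1 x ⊗ 1_2 y], and gamma is invertible iff some [β]
   satisfies [sigma β = kappa] and [β sigma = balance].  An antipode gives
   [β (x ⊗ y) = x_1 ⊗ S(x_2) y], and conversely [S x = (ε H) β (x ⊗ 1)].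

   Given [S], the idempotent [m ↦ S(m_{-1}) m_0] of a mixed bimodule splits
   through its coinvariants, which are both left and right adjoint to [K_omega];
   the composite [M -> K Q M -> M] of unit and counit is the identity, so this
   functor is separable, hence monadic and comonadic because idempotents split.
   Conversely, if an adjoint of [K_omega] is (co)monadic, separability makes every
   mixed bimodule a retract of some [K N]; for the cofree bimodule [G a] this
   retraction yields [β].  The statement about gamma' is the one about gamma for
   the opposite category, the notion of weak braided bimonad being self-dual. *)
From Stdlib Require Import IndefiniteDescription.
Require Import Defs.

Set Implicit Arguments.
Unset Strict Implicit.
Unset Printing Implicit Defensive.
Local Open Scope cat_scope.
#[local] Obligation Tactic := intros; simpl.

(** * Opposites *)

(** The pivot between the conditions is [IsGalois], a system of equations in [A] at each object. In
    this form no coequaliser of functors is left and the condition makes sense verbatim over [op A];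
    naturality comes for free because the equations determine the inverse.

    In (b) and (c) the adjoint is arbitrary and nothing is known about its values, while
    separability of the base yields a section of the counit (a retraction of the unit) only at
    objects [K a]. Full faithfulness of the comparison functor carries it from there to every mixed
    bimodule, in particular to [G a].

    Choice is used to turn existence statements into data: Galois inverses, splittings of
    idempotents, and inverses of functors that are fully faithful and essentially surjective. *)

Definition op (C : Category) : Category := {|
  Obj := Obj C;
  Hom := fun a b => @Hom C b a;
  idm := fun a => @idm C a;
  comp := fun a b c g f => @comp C c b a f g;
  comp_idl := fun a b f => comp_idr f;
  comp_idr := fun a b f => comp_idl f;
  comp_assoc := fun a b c d h g f => eq_sym (comp_assoc f g h)
|}.

Definition opF (C D : Category) (F : Functor C D) : Functor (op C) (op D) := {|
  fobj := fun a : op C => F a : op D;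
  fmap := fun a b f => @fmap C D F b a f;
  fmap_id := fun a => fmap_id F a;
  fmap_comp := fun a b c g f => fmap_comp F f g
|}.

Lemma comp_tail (C : Category) (a b c : C) (f g : Hom b c) (x : Hom a b) :
  f = g -> f ∘ x = g ∘ x.
Proof. now intros ->. Qed.

Ltac whisk :=
  cbn [fobj fmap component compF idF whiskerL whiskerR hcomp compN idN
    mix_obj mix_act mix_coact K_obj K_omega].
Ltac whisk_in E :=
  cbn [fobj fmap component compF idF whiskerL whiskerR hcomp compN idN
    mix_obj mix_act mix_coact K_obj K_omega] in E.
Ltac flat :=
  whisk; rewrite ?fmap_comp, ?fmap_id, <- ?comp_assoc, ?comp_idl, ?comp_idr.
Ltac flat_in E :=
  whisk_in E;
  rewrite ?fmap_comp, ?fmap_id, <- ?comp_assoc, ?comp_idl, ?comp_idr in E.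

Ltac tailed l x :=
  lazymatch l with
  | ?f ∘ ?g => let g' := tailed g x in constr:(f ∘ g')
  | idm _ => x
  | _ => constr:(l ∘ x)
  end.

(* [rw E] rewrites with [E : g₁ ∘ … ∘ gₙ = …] anywhere inside a right-nested
   composite. *)
Ltac rw_with tac E :=
  let X := fresh "E" in
  pose proof E as X; flat_in X; flat;
  first
  [ tac X
  | lazymatch type of X with
    | @eq (@Hom ?C ?a ?b) ?l ?r =>
      let Y := fresh "E" in
      assert (Y : forall z_ (x_ : @Hom C z_ a),
        ltac:(let l' := tailed l x_ in let r' := tailed r x_ in
              exact (l' = r')))
        by (intros z_ x_;
            let Q := fresh in
            pose proof (comp_tail x_ X) as Q;
            rewrite <- ?comp_assoc, ?comp_idl in Q; exact Q);
      whisk_in Y; tac Y; clear Y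
    end ];
  clear X; flat.
Ltac rw E := rw_with ltac:(fun X => rewrite X) E.
Ltac rwb E := rw_with ltac:(fun X => rewrite <- X) E.
Ltac flat_exact E := let X := fresh "E" in pose proof E as X; flat_in X; exact X.

Definition opN (C D : Category) (F G : Functor C D) (α : NatTrans F G) :
  NatTrans (opF G) (opF F) :=
  Build_NatTrans (F := opF G) (G := opF F) (component := fun a => α a)
    (fun a b f => eq_sym (naturality α f)).

Section OpBimonad.
Context (A : Category) (B : WeakBraidedBimonad A).
Local Notation H := (wbb_fun B).

Definition op_m : NatTrans (opF H ⊙ opF H) (opF H) :=
  Build_NatTrans (F := opF H ⊙ opF H) (G := opF H)
    (component := fun a => wbb_δ B a)
    (fun a b f => eq_sym (naturality (wbb_δ B) f)).
Definition op_e : NatTrans (idF (op A)) (opF H) :=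
  Build_NatTrans (F := idF (op A)) (G := opF H)
    (component := fun a => wbb_ε B a)
    (fun a b f => eq_sym (naturality (wbb_ε B) f)).
Definition op_δ : NatTrans (opF H) (opF H ⊙ opF H) :=
  Build_NatTrans (F := opF H) (G := opF H ⊙ opF H)
    (component := fun a => wbb_m B a)
    (fun a b f => eq_sym (naturality (wbb_m B) f)).
Definition op_ε : NatTrans (opF H) (idF (op A)) :=
  Build_NatTrans (F := opF H) (G := idF (op A))
    (component := fun a => wbb_e B a)
    (fun a b f => eq_sym (naturality (wbb_e B) f)).
Definition op_HH (α : NatTrans (H ⊙ H) (H ⊙ H)) :
  NatTrans (opF H ⊙ opF H) (opF H ⊙ opF H) :=
  Build_NatTrans (F := opF H ⊙ opF H) (G := opF H ⊙ opF H)
    (component := fun a => α a)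
    (fun a b f => eq_sym (naturality α f)).

Lemma op_isMonad : IsMonad op_m op_e.
Proof.
  destruct (wbb_isComonad (wbb_law B)) as [E1 E2 E3]; split; assumption.
Qed.
Lemma op_isComonad : IsComonad op_δ op_ε.
Proof.
  destruct (wbb_isMonad (wbb_law B)) as [E1 E2 E3]; split; assumption.
Qed.
Lemma op_isYB : IsWeakYBPair (op_HH (wbb_τ B)) (op_HH (wbb_τ' B)).
Proof.
  destruct (wbb_isYB (wbb_law B)) as [E1 E2 E3 E4 E5 E6 E7 E8 E9].
  split; intros a; simpl in *; rewrite ?comp_assoc; auto.
  - now rewrite <- E3, E6.
  - now rewrite <- (comp_assoc (fmap H _)), <- E3, E7.
  - now rewrite <- E3, E8.
  - now rewrite <- (comp_assoc (fmap H _)), <- E3, E9.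
Qed.

Lemma op_isWeakBraidedBimonad : IsWeakBraidedBimonad op_m op_e op_δ op_ε
  (op_HH (wbb_τ B)) (op_HH (wbb_τ' B)).
Proof.
  destruct (wbb_law B) as [C1 C2 C3 C4 C5 C6 C7 C8 C9 C10 C11 C12 C13 C14 C15
    C16 C17 C18].
  pose proof (yb_comm C3) as E3.
  split; [exact op_isMonad | exact op_isComonad | exact op_isYB | ..];
    intros a; simpl in *; rewrite <- ?E3, ?comp_assoc; auto.
  all: rewrite <- ?comp_assoc in *; auto.
  (* In the opposite category [⋆] composes its factors in the other order of the interchange law;
     naturality of the structure maps corrects this here and in the next bullets. *)
  - rw (naturality (wbb_m B) (wbb_m B a)).
    rw (naturality (wbb_δ B) (wbb_δ B a)). flat_exact (C14 a).
  - rw (naturality (wbb_δ B) (wbb_δ B a)).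
    rw (naturality (wbb_e B) (wbb_e B a)). flat_exact (C17 a).
  - rw (naturality (wbb_δ B) (wbb_δ B a)).
    rw (naturality (wbb_e B) (wbb_e B a)). flat_exact (C18 a).
  - rw (naturality (wbb_m B) (wbb_m B a)).
    rw (naturality (wbb_ε B) (wbb_ε B a)). flat_exact (C15 a).
  - rw (naturality (wbb_m B) (wbb_m B a)).
    rw (naturality (wbb_ε B) (wbb_ε B a)). flat_exact (C16 a).
Qed.
End OpBimonad.

Definition opB (A : Category) (B : WeakBraidedBimonad A) :
  WeakBraidedBimonad (op A) := Build_WeakBraidedBimonad
    (op_isWeakBraidedBimonad B).

(** * The derived transformations and their duals *)

Section Unfold.
Context (A : Category) (B : WeakBraidedBimonad A) (a : A).
Local Notation H := (wbb_fun B).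
Local Notation m := (wbb_m B).
Local Notation e := (wbb_e B).
Local Notation δ := (wbb_δ B).
Local Notation ε := (wbb_ε B).
Local Notation τ := (wbb_τ B).

(** These equations replace unfolding: the derived transformations become opaque below, so that
    rewriting meets them as units. *)
Lemma omegaE : omega B a = m (H a) ∘ fmap H (τ a) ∘ δ (H a).
Proof. reflexivity. Qed.
Lemma omegabarE : omegabar B a = fmap H (m a) ∘ τ (H a) ∘ fmap H (δ a).
Proof. reflexivity. Qed.
Lemma xiE : xi B a = ε (H a) ∘ omega B a ∘ e (H a).
Proof. reflexivity. Qed.
Lemma xibarE : xibar B a = fmap H (ε a) ∘ omegabar B a ∘ fmap H (e a).
Proof. reflexivity. Qed.
Lemma sigmaE : sigma B a = fmap H (m a) ∘ δ (H a).
Proof. reflexivity. Qed.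
Lemma kappaE : kappa B a = fmap H (m a) ∘ omega B (H a) ∘ e (H (H a)).
Proof. reflexivity. Qed.
Lemma kappa'E : kappa' B a = ε (H (H a)) ∘ omega B (H a) ∘ fmap H (δ a).
Proof. reflexivity. Qed.
End Unfold.

Section OpDerived.
Context (A : Category) (B : WeakBraidedBimonad A) (a : op A).

Lemma omega_op : omega (opB B) a = omega B a :> @Hom A _ _.
Proof. rewrite omegaE, (omegaE B). simpl. now rewrite comp_assoc. Qed.

Lemma omegabar_op : omegabar (opB B) a = omegabar B a :> @Hom A _ _.
Proof. rewrite omegabarE, (omegabarE B). simpl. now rewrite comp_assoc. Qed.
End OpDerived.

Section OpDerived2.
Context (A : Category) (B : WeakBraidedBimonad A) (a : op A).

Lemma xi_op : xi (opB B) a = xi B a :> @Hom A _ _.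
Proof.
  rewrite xiE, (xiE B), omega_op. simpl. now rewrite comp_assoc.
Qed.

Lemma xibar_op : xibar (opB B) a = xibar B a :> @Hom A _ _.
Proof.
  rewrite xibarE, (xibarE B), omegabar_op. simpl. now rewrite comp_assoc.
Qed.

Lemma sigma_op : sigma (opB B) a = sigmabar B a :> @Hom A _ _.
Proof. reflexivity. Qed.

Lemma kappa_op : kappa (opB B) a = kappa' B a :> @Hom A _ _.
Proof.
  rewrite kappaE, (kappa'E B), omega_op. simpl. now rewrite comp_assoc.
Qed.
End OpDerived2.

#[local] Opaque omega omegabar xi xibar sigma sigmabar kappa kappa'.

(* A statement about the opposite bimonad is convertible to its dual up to
   bracketing. *)
Ltac dual_exact E :=
  let X := fresh "E" in
  pose proof E as X;
  rewrite ?omega_op, ?omegabar_op, ?xi_op, ?xibar_op, ?sigma_op, ?kappa_op in X;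
  simpl in X; flat_in X; flat; exact X.

(* [lhs] hides the right-hand side in a local definition, so that only the
   left-hand side is rewritten. *)
Ltac lhs :=
  flat;
  lazymatch goal with
  | |- ?l = ?r => let R := fresh "R" in pose (R := r); change (l = R)
  end.
Ltac rhs := symmetry; lhs.
Ltac close :=
  lazymatch goal with |- _ = ?R => unfold R; clear R end; flat; reflexivity.

(** * Calculus in a weak braided bimonad *)

Section Calculus.
Context (A : Category) (B : WeakBraidedBimonad A).
Implicit Types a b : A.
Local Notation H := (wbb_fun B).
Local Notation m := (wbb_m B).
Local Notation e := (wbb_e B).
Local Notation τ := (wbb_τ B).
Local Notation τ' := (wbb_τ' B).
Local Notation "⟨ f ⟩" := (fmap (wbb_fun B) f) (at level 0, format "⟨ f ⟩").
Local Notation W := (wbb_law B).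
Local Notation YB := (wbb_isYB (wbb_law B)).
Local Notation mon := (wbb_isMonad (wbb_law B)).

(** Composed with [τ], the right-hand side gives [τ] back, by the law for [τ · mH] and the unit law.
    It also absorbs [∇ = τ · τ'] on its right, because [m · ∇ = m]. Hence it is [∇]. *)
Lemma nabla_unitl a : τ a ∘ τ' a = ⟨m a⟩ ∘ τ (H a) ∘ e (H (H a)).
Proof.
  assert (L : ⟨m a⟩ ∘ (τ (H a) ∘ (e (H (H a)) ∘ τ a)) = τ a).
  { rw (naturality e (τ a)). rwb (wbb_τ_mH W a). now rw (monad_unitl mon (H a)). }
  symmetry; flat.
  rwb (f_equal (fmap H) (wbb_m_nabla W a)).
  rwb (yb_nablaR YB a).
  rwb (naturality e (τ' a)). rwb (naturality e (τ a)).
  now rw L.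
Qed.

Lemma nabla_unitr a : τ a ∘ τ' a = m (H a) ∘ ⟨τ a⟩ ∘ ⟨⟨e a⟩⟩.
Proof.
  assert (L : m (H a) ∘ (⟨τ a⟩ ∘ (⟨⟨e a⟩⟩ ∘ τ a)) = τ a).
  { rwb (naturality τ (e a)). rwb (wbb_τ_Hm W a).
    now rw (f_equal (fmap H) (monad_unitr mon a)). }
  symmetry; flat.
  rwb (wbb_m_nabla W (H a)). rwb (yb_nablaL YB a).
  rw (naturality τ' (e a)). rw (naturality τ (e a)).
  now rw L.
Qed.

Lemma nabla_mH a : τ a ∘ τ' a ∘ m (H a) = m (H a) ∘ ⟨τ a⟩ ∘ ⟨τ' a⟩.
Proof.
  rw (nabla_unitr a). rw (f_equal (fmap H) (nabla_unitr a)).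
  rwb (naturality m (⟨e a⟩)). rwb (naturality m (τ a)).
  now rw (monad_assoc mon (H a)).
Qed.

Lemma nabla_Hm a : τ a ∘ τ' a ∘ ⟨m a⟩ = ⟨m a⟩ ∘ τ (H a) ∘ τ' (H a).
Proof.
  rw (nabla_unitl a). rw (nabla_unitl (H a)).
  rw (naturality e (⟨m a⟩)). rw (naturality τ (m a)).
  now rwb (f_equal (fmap H) (monad_assoc mon a)).
Qed.

(** On the image of [∇] the law for [τ · Hm] can be inverted, which exchanges the roles of [Hm] and
    [mH]. *)
Lemma tau'_mH a : τ' a ∘ m (H a) = ⟨m a⟩ ∘ τ' (H a) ∘ ⟨τ' a⟩.
Proof.
  lhs. rwb (yb_regular' YB a). rw (nabla_mH a).
  rwb (wbb_m_nabla W (H a)). rwb (yb_nablaL YB a).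
  rwb (wbb_τ_Hm W a). rwb (yb_comm YB a). rw (nabla_Hm a).
  rw (yb_comm YB (H a)). rw (yb_regular' YB (H a)). close.
Qed.

End Calculus.

Section DualCalculus.
Context (A : Category) (B : WeakBraidedBimonad A).
Implicit Types a b : A.
Local Notation H := (wbb_fun B).
Local Notation m := (wbb_m B).
Local Notation e := (wbb_e B).
Local Notation δ := (wbb_δ B).
Local Notation ε := (wbb_ε B).
Local Notation τ := (wbb_τ B).
Local Notation τ' := (wbb_τ' B).
Local Notation "⟨ f ⟩" := (fmap (wbb_fun B) f) (at level 0, format "⟨ f ⟩").
Local Notation W := (wbb_law B).
Local Notation YB := (wbb_isYB (wbb_law B)).
Local Notation mon := (wbb_isMonad (wbb_law B)).
Local Notation com := (wbb_isComonad (wbb_law B)).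

Lemma nabla_δH a : δ (H a) ∘ τ a ∘ τ' a = ⟨τ a⟩ ∘ ⟨τ' a⟩ ∘ δ (H a).
Proof.
  rw (yb_comm YB a). rw (f_equal (fmap H) (yb_comm YB a)).
  dual_exact (nabla_mH (opB B) a).
Qed.

(* The argument stays to the right of [δ e], at the price of a [τ'] under the
   counit; this is the shape in which the second half of axiom (7) applies. *)
Lemma xibar_alt a :
  xibar B a = ⟨ε a⟩ ∘ ⟨m a⟩ ∘ ⟨τ' a⟩ ∘ δ (H a) ∘ e (H a).
Proof.
  rewrite xibarE, omegabarE. lhs. rwb (f_equal (fmap H) (wbb_m_nabla W a)).
  rw (f_equal (fmap H) (yb_comm YB a)).
  rwb (wbb_δH_τ W a). rwb (wbb_nabla_eH W a). rw (nabla_δH a).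
  rw (f_equal (fmap H) (yb_comm YB a)).
  rwb (f_equal (fmap H) (yb_comm YB a)).
  rw (f_equal (fmap H) (yb_regular' YB a)). close.
Qed.

Lemma xibar_δe a : xibar B (H a) ∘ δ a ∘ e a = δ a ∘ e a.
Proof.
  rw (xibar_alt (H a)). lhs.
  rw (naturality e (δ a)). rw (naturality δ (δ a)). rw (naturality e (e a)).
  rwb (wbb_unit' W a). rw (comonad_counitr com (H a)). close.
Qed.

(** Axiom (6) splits [ε(x y 1_2)] as [ε(x y_1) ε(y_2 1_2)]. The remaining rewrites move the factor
    [ε(x y_1)] across the crossings, and the [∇] that this leaves is absorbed by [δ]. *)
Lemma xibar_m a : xibar B a ∘ m a = xibar B a ∘ ε (H a) ∘ m (H a) ∘ ⟨δ a⟩.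
Proof.
  rewrite xibarE, omegabarE. lhs.
  rwb (naturality m (e a)). rwb (naturality m (δ a)). rw (wbb_τ_mH W (H a)).
  rwb (f_equal (fmap H) (wbb_counit W a)).
  rwb (naturality τ (δ (H a))). rw (f_equal (fmap H) (wbb_Hδ_τ W (H a))).
  rw (f_equal (fmap H) (naturality δ (δ a))).
  rw (f_equal (fmap H) (naturality δ (e a))).
  rw (f_equal (fmap H) (naturality ε (m a))).
  rwb (wbb_τ_mH W (H (H a))). rwb (wbb_εH_nabla W (H (H a))).
  rw (nabla_mH B (H (H a))).
  rwb (f_equal (fmap H) (yb_nablaL YB (H a))).
  rw (f_equal (fmap H) (naturality τ' (δ a))).
  rw (f_equal (fmap H) (naturality τ (δ a))).
  rw (f_equal (fmap H) (naturality τ' (e a))).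
  rw (f_equal (fmap H) (naturality τ (e a))).
  rw (f_equal (fmap H) (wbb_nabla_δ W a)).
  rw (naturality m (τ (H a))). rw (naturality ε (τ (H a))).
  rw (naturality m (⟨δ a⟩)). rw (naturality ε (⟨δ a⟩)).
  rw (naturality m (⟨e a⟩)). rw (naturality ε (⟨e a⟩)).
  close.
Qed.

(** The Yang-Baxter equation with one [τ] cancelled on each side. Cancellation holds only up to [∇],
    which commutes with the other crossings. *)
Lemma yb_mixed a :
  τ' (H a) ∘ ⟨τ a⟩ ∘ τ (H a) = ⟨τ a⟩ ∘ τ (H a) ∘ ⟨τ' a⟩.
Proof.
  lhs. rwb (f_equal (fmap H) (yb_regular YB a)).
  rwb (f_equal (fmap H) (yb_comm YB a)). rwb (yb_nablaR YB a).
  rw (yb_braid YB a). rwb (yb_comm YB (H a)). rwb (yb_nablaL YB a).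
  rw (yb_regular YB (H a)). close.
Qed.

Lemma counit_m_tau' a :
  ⟨ε a⟩ ∘ ⟨m a⟩ ∘ τ' (H a) = ε (H a) ∘ m (H a) ∘ ⟨τ a⟩.
Proof.
  lhs. rwb (f_equal (fmap H) (wbb_m_nabla W a)). rwb (yb_nablaR' YB a).
  rw (f_equal (fmap H) (yb_comm YB a)). rwb (tau'_mH B a).
  rwb (yb_regular' YB a). rwb (yb_comm YB a). rw (wbb_Hε_nabla W a).
  rw (nabla_mH B a). rw (f_equal (fmap H) (yb_regular YB a)). close.
Qed.

(** The left-hand side is what the [τ'] half of axiom (6) leaves at the unit in [counit_omega]; it
    is isolated so as to be recognised there as [δ · xi]. *)
Lemma xi_coproduct a :
  ⟨ε (H a)⟩ ∘ ⟨m (H a)⟩ ∘ ⟨⟨τ a⟩⟩ ∘ τ' (H (H a)) ∘ δ (H (H a)) ∘ δ (H a)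
    ∘ e (H a) = δ a ∘ xi B a.
Proof.
  lhs. rwb (naturality τ' (τ a)). rw (counit_m_tau' (H a)).
  rw (comonad_coassoc com (H a)). rwb (f_equal (fmap H) (wbb_Hδ_τ W a)).
  rw (naturality m (δ a)). rw (naturality ε (δ a)).
  unfold R; rewrite xiE, omegaE. flat. reflexivity.
Qed.

(* The identity [x 1_2 ε(1_1 y) = ε(x_1 y) x_2] of weak bialgebras. *)
Lemma counit_omega a : ε (H a) ∘ omega B a = m a ∘ ⟨xi B a⟩.
Proof.
  rewrite omegaE.
  (* Replacing [x] by [x 1] makes axiom (5) applicable to [δ(x 1)]; the threefold product
     [x_1 1_1 y] that then stands under [ε] is the one in axiom (6). *)
  transitivity (ε (H a) ∘ m (H a) ∘ ⟨τ a⟩ ∘ δ (H a) ∘ m (H a) ∘ ⟨e (H a)⟩);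
    [now rw (monad_unitr mon (H a)) |]. lhs.
  rw (wbb_δ_m W (H a)). rw (f_equal (fmap H) (wbb_τ_mH W a)).
  rwb (naturality m (⟨τ a⟩)). rwb (naturality m (τ (H a))).
  rwb (naturality m (⟨m a⟩)). rw (wbb_counit' W (H a)).
  rw (f_equal (fmap H) (naturality δ (⟨m a⟩))).
  rw (f_equal (fmap H) (naturality δ (τ (H a)))).
  rw (f_equal (fmap H) (naturality δ (⟨τ a⟩))).
  rw (f_equal (fmap H) (wbb_δH_τ W (H (H a)))).
  rw (f_equal (fmap H) (naturality τ' (⟨m a⟩))).
  rw (f_equal (fmap H) (naturality τ' (τ (H a)))).
  rw (f_equal (fmap H) (naturality τ' (⟨τ a⟩))).
  rw (f_equal (fmap H) (yb_mixed (H (H a)))).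
  rwb (naturality m (m (H a))).
  rw (f_equal (fmap H) (f_equal (fmap H) (naturality m (m a)))).
  rwb (f_equal (fmap H) (f_equal (fmap H) (naturality τ (τ a)))).
  rwb (f_equal (fmap H) (f_equal (fmap H) (wbb_τ_Hm W (H a)))).
  rwb (naturality ε (ε (H a))). rwb (naturality m (ε (H a))).
  rw (f_equal (fmap H) (f_equal (fmap H) (naturality ε (m a)))).
  rwb (f_equal (fmap H) (f_equal (fmap H) (wbb_Hε_nabla W (H a)))).
  rw (f_equal (fmap H) (f_equal (fmap H) (nabla_Hm B (H a)))).
  rw (f_equal (fmap H) (f_equal (fmap H) (naturality τ' (τ a)))).
  rw (f_equal (fmap H) (f_equal (fmap H) (naturality τ (τ a)))).
  rwb (f_equal (fmap H) (yb_nablaR YB (H (H a)))).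
  rw (f_equal (fmap H) (f_equal (fmap H) (yb_comm YB (H (H a))))).
  rw (f_equal (fmap H) (f_equal (fmap H) (yb_regular' YB (H (H a))))).
  rwb (f_equal (fmap H) (naturality τ (⟨τ a⟩))).
  rwb (f_equal (fmap H) (naturality τ (m (H a)))).
  rwb (f_equal (fmap H) (naturality τ (ε (H a)))).
  rw (naturality δ (e (H a))).
  rw (f_equal (fmap H) (f_equal (fmap H) (xi_coproduct a))).
  rwb (naturality δ (xi B a)). rw (naturality m (m a)).
  rwb (wbb_δ_m W a). rw (comonad_counitl com a). close.
Qed.

(* The underlying cancellation is [x_1 1_1 ε(x_2 1_2) = x]. *)
Lemma convolution_id_xibar a : m a ∘ ⟨xibar B a⟩ ∘ δ a = idm (H a).
Proof.
  rewrite xibarE, omegabarE. lhs.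
  rw (naturality m (ε a)). rw (naturality m (m a)).
  rwb (naturality δ (e a)). rwb (wbb_δ_m W a).
  rw (monad_unitr mon a). rw (comonad_counitr com a). close.
Qed.

(** One of the laws that make [ω] a weak mixed distributive law; the diagonal action is associative
    because of it. *)
Lemma omega_mH a : omega B a ∘ m (H a) = ⟨m a⟩ ∘ omega B (H a) ∘ ⟨omega B a⟩.
Proof.
  rewrite !omegaE. lhs.
  rw (wbb_δ_m W (H a)). rw (f_equal (fmap H) (wbb_τ_mH W a)).
  rwb (naturality m (⟨τ a⟩)). rwb (naturality m (τ (H a))).
  rwb (naturality m (⟨m a⟩)). unfold R; clear R. rhs.
  rw (naturality δ (m (H a))). rw (naturality δ (⟨τ a⟩)).
  rw (naturality δ (δ (H a))). rw (f_equal (fmap H) (wbb_τ_Hm W (H a))).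
  rw (f_equal (fmap H) (naturality τ (τ a))).
  rwb (naturality m (m a)). rwb (f_equal (fmap H) (naturality m (m a))).
  rwb (monad_assoc mon (H a)). close.
Qed.
End DualCalculus.

(** * The image of [xibar] as a base for [H] *)

Section Counital.
Context (A : Category) (B : WeakBraidedBimonad A).
Implicit Types a b : A.
Local Notation H := (wbb_fun B).
Local Notation m := (wbb_m B).
Local Notation e := (wbb_e B).
Local Notation δ := (wbb_δ B).
Local Notation ε := (wbb_ε B).
Local Notation "⟨ f ⟩" := (fmap (wbb_fun B) f) (at level 0, format "⟨ f ⟩").
Local Notation mon := (wbb_isMonad (wbb_law B)).
Local Notation com := (wbb_isComonad (wbb_law B)).

Lemma omega_δH a : δ (H a) ∘ omega B a = ⟨omega B a⟩ ∘ omega B (H a) ∘ ⟨δ a⟩.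
Proof. dual_exact (omega_mH (opB B) a). Qed.

Lemma omega_eH a : omega B a ∘ e (H a) = ⟨xi B a⟩ ∘ δ a.
Proof. dual_exact (counit_omega (opB B) a). Qed.

Lemma counit_m_xibar a : ε a ∘ m a ∘ xibar B (H a) = ε a ∘ m a.
Proof. dual_exact (xibar_δe (opB B) a). Qed.

Lemma δ_xibar a :
  δ a ∘ xibar B a = ⟨m a⟩ ∘ δ (H a) ∘ e (H a) ∘ xibar B a.
Proof. dual_exact (xibar_m (opB B) a). Qed.

(** Applying [ε] to the second leg of the hypothesis gives [g = 1_1 ε(1_2 g)], and [xibar] fixes the
    first leg of [δ e]. *)
Lemma xibar_coinvariant a b (g : Hom b (H a)) :
  δ a ∘ g = ⟨m a⟩ ∘ δ (H a) ∘ e (H a) ∘ g -> xibar B a ∘ g = g.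
Proof.
  intros E. assert (Eg : g = ⟨ε a⟩ ∘ ⟨m a⟩ ∘ δ (H a) ∘ e (H a) ∘ g).
  { rwb E. now rw (comonad_counitr com a). }
  transitivity (⟨ε a⟩ ∘ ⟨m a⟩ ∘ δ (H a) ∘ e (H a) ∘ g); [| now symmetry].
  refine (eq_trans (f_equal (comp (xibar B a)) Eg) _). lhs.
  rw (naturality (xibar B) (ε a)). rw (naturality (xibar B) (m a)).
  rw (xibar_δe B (H a)). close.
Qed.

Lemma xibar_e a : xibar B a ∘ e a = e a.
Proof.
  apply xibar_coinvariant. flat. rw (naturality e (e a)).
  rw (naturality δ (e a)). now rw (f_equal (fmap H) (monad_unitr mon a)).
Qed.

(** By [xibar_m] the left factor of [xibar (x y)] enters only through [ε(x y_1)], which does not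
    distinguish [x] from [xibar x]. *)
Lemma xibar_m_xibar a : xibar B a ∘ m a ∘ xibar B (H a) = xibar B a ∘ m a.
Proof.
  lhs. rw (xibar_m B a). rwb (naturality (xibar B) (δ a)).
  rw (counit_m_xibar (H a)). rwb (xibar_m B a). close.
Qed.

(** On the image of [xibar], [δ y] is [1_1 ⊗ 1_2 y], so its diagonal product with [δ x] collapses to
    [δ(x 1)] times [y]. This is the linearity of [δ] over the base. *)
Lemma δ_m_xibar a : δ a ∘ m a ∘ ⟨xibar B a⟩ = ⟨m a⟩ ∘ δ (H a) ∘ ⟨xibar B a⟩.
Proof.
  lhs. rw (K_compat B a). rw (f_equal (fmap H) (δ_xibar a)).
  rw (naturality (omega B) (m a)).
  rwb (f_equal (fmap H) (monad_assoc mon a)). rwb (K_compat B (H a)).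
  rw (monad_unitr mon (H a)). close.
Qed.

Lemma xibar_mul_closed a :
  xibar B a ∘ m a ∘ xibar B (H a) ∘ ⟨xibar B a⟩
    = m a ∘ xibar B (H a) ∘ ⟨xibar B a⟩.
Proof.
  rewrite <- !comp_assoc. apply xibar_coinvariant. flat.
  rw (naturality (xibar B) (xibar B a)).
  lhs. rw (δ_m_xibar a). rwb (naturality (xibar B) (xibar B a)).
  rw (δ_xibar (H a)). unfold R; clear R. rhs.
  rw (naturality e (m a)). rw (naturality δ (m a)).
  rwb (f_equal (fmap H) (monad_assoc mon a)).
  rwb (naturality (xibar B) (xibar B a)). close.
Qed.
End Counital.

Lemma counit_xibar (A : Category) (B : WeakBraidedBimonad A) (a : A) :
  wbb_ε B a ∘ xibar B a = wbb_ε B a.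
Proof. dual_exact (xibar_e (opB B) a). Qed.

(** * Galois inverses and antipodes *)

Definition balance (A : Category) (B : WeakBraidedBimonad A) (a : A) :
  Hom (B (B a)) (B (B a)) :=
  fmap B (wbb_m B a) ∘ fmap B (xibar B (B a)) ∘ wbb_δ B (B a).

(** The third equation normalises [β]: its values lie in the summand of [HH] that represents the
    relative tensor product. It makes [β] unique, and it yields the antipode equation
    [S * 1 * S = S]. *)
Record IsGaloisInverse (A : Category) (B : WeakBraidedBimonad A) (a : A)
  (β : Hom (B (B a)) (B (B a))) : Prop := {
  galois_retr : sigma B a ∘ β = kappa B a;
  galois_sect : β ∘ sigma B a = balance B a;
  galois_balance : balance B a ∘ β = β
}.

Definition IsGalois (A : Category) (B : WeakBraidedBimonad A) : Prop :=
  forall a, exists β, IsGaloisInverse (B := B) (a := a) β.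

Section Galois.
Context (A : Category) (B : WeakBraidedBimonad A).
Implicit Types a b : A.
Local Notation H := (wbb_fun B).
Local Notation m := (wbb_m B).
Local Notation e := (wbb_e B).
Local Notation δ := (wbb_δ B).
Local Notation ε := (wbb_ε B).
Local Notation "⟨ f ⟩" := (fmap (wbb_fun B) f) (at level 0, format "⟨ f ⟩").
Local Notation mon := (wbb_isMonad (wbb_law B)).
Local Notation com := (wbb_isComonad (wbb_law B)).

Lemma kappa_alt a : kappa B a = ⟨m a⟩ ∘ ⟨xi B (H a)⟩ ∘ δ (H a).
Proof. rewrite kappaE. lhs. rw (omega_eH B (H a)). close. Qed.

(* [balance] splits the coequaliser of [rho_rH] and [Hrho_l]. *)
Lemma comp_balance a b (k : Hom (H (H a)) b) :
  k ∘ m (H a) ∘ ⟨xibar B (H a)⟩ = k ∘ ⟨m a⟩ ∘ ⟨xibar B (H a)⟩ ->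
  k ∘ balance B a = k.
Proof.
  intros E. unfold balance. lhs. rwb E. rw (convolution_id_xibar B (H a)).
  close.
Qed.

Lemma balance_coequalizes a :
  balance B a ∘ m (H a) ∘ ⟨xibar B (H a)⟩
    = balance B a ∘ ⟨m a⟩ ∘ ⟨xibar B (H a)⟩.
Proof.
  unfold balance. lhs. rw (δ_m_xibar B (H a)).
  rwb (f_equal (fmap H) (xibar_m_xibar B (H a))).
  rw (naturality δ (xibar B (H a))).
  rw (f_equal (fmap H) (xibar_mul_closed B (H a))).
  unfold R; clear R. rhs.
  rw (naturality δ (m a)). rw (f_equal (fmap H) (naturality (xibar B) (m a))).
  rw (naturality δ (xibar B (H a))). rwb (f_equal (fmap H) (monad_assoc mon a)).
  close.
Qed.

Lemma sigma_coequalizes a :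
  sigma B a ∘ m (H a) ∘ ⟨xibar B (H a)⟩
    = sigma B a ∘ ⟨m a⟩ ∘ ⟨xibar B (H a)⟩.
Proof.
  rewrite sigmaE. lhs. rw (δ_m_xibar B (H a)).
  rw (f_equal (fmap H) (monad_assoc mon a)). rwb (naturality δ (m a)). close.
Qed.

Lemma sigma_balance a : sigma B a ∘ balance B a = sigma B a.
Proof. apply comp_balance, sigma_coequalizes. Qed.

Lemma balance_idem a : balance B a ∘ balance B a = balance B a.
Proof. apply comp_balance, balance_coequalizes. Qed.

Lemma sigma_mH a :
  sigma B a ∘ m (H a) = ⟨m a⟩ ∘ omega B (H a) ∘ ⟨sigma B a⟩.
Proof.
  rewrite sigmaE. lhs. rw (K_compat B (H a)).
  rw (f_equal (fmap H) (monad_assoc mon a)).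
  unfold R; clear R. rhs. rw (naturality (omega B) (m a)). close.
Qed.

Lemma kappa_sigma a : kappa B a ∘ sigma B a = sigma B a.
Proof.
  rewrite kappaE. lhs. rw (naturality e (sigma B a)).
  rwb (sigma_mH a). rw (monad_unitl mon (H a)). close.
Qed.

Lemma balance_natural a b (f : Hom a b) :
  balance B b ∘ ⟨⟨f⟩⟩ = ⟨⟨f⟩⟩ ∘ balance B a.
Proof.
  unfold balance. lhs. rw (naturality δ (⟨f⟩)).
  rw (f_equal (fmap H) (naturality (xibar B) (⟨f⟩))).
  rw (f_equal (fmap H) (naturality m f)). close.
Qed.

Lemma δ_balance a : δ (H a) ∘ balance B a = ⟨balance B a⟩ ∘ δ (H a).
Proof.
  unfold balance. lhs. rw (naturality δ (m a)).
  rw (naturality δ (xibar B (H a))). rw (comonad_coassoc com (H a)). close.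
Qed.

Lemma δ_sigma a : δ (H a) ∘ sigma B a = ⟨sigma B a⟩ ∘ δ (H a).
Proof.
  rewrite sigmaE. lhs. rw (naturality δ (m a)).
  rw (comonad_coassoc com (H a)). close.
Qed.

Lemma δ_kappa a : δ (H a) ∘ kappa B a = ⟨kappa B a⟩ ∘ δ (H a).
Proof.
  rewrite kappa_alt. lhs. rw (naturality δ (m a)).
  rw (naturality δ (xi B (H a))). rw (comonad_coassoc com (H a)). close.
Qed.

Lemma balance_Hm a : balance B a ∘ ⟨m a⟩ = ⟨m a⟩ ∘ balance B (H a).
Proof.
  unfold balance. lhs. rw (naturality δ (m a)).
  rw (f_equal (fmap H) (naturality (xibar B) (m a))).
  rwb (f_equal (fmap H) (monad_assoc mon a)). close.
Qed.

Lemma sigma_Hm a : sigma B a ∘ ⟨m a⟩ = ⟨m a⟩ ∘ sigma B (H a).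
Proof.
  rewrite !sigmaE. lhs. rw (naturality δ (m a)).
  rwb (f_equal (fmap H) (monad_assoc mon a)). close.
Qed.

Lemma kappa_Hm a : kappa B a ∘ ⟨m a⟩ = ⟨m a⟩ ∘ kappa B (H a).
Proof.
  rewrite !kappa_alt. lhs. rw (naturality δ (m a)).
  rw (f_equal (fmap H) (naturality (xi B) (m a))).
  rwb (f_equal (fmap H) (monad_assoc mon a)). close.
Qed.

Lemma counit_sigma a : ε (H a) ∘ sigma B a = m a.
Proof.
  rewrite sigmaE. lhs. rw (naturality ε (m a)).
  rw (comonad_counitl com (H a)). close.
Qed.

Lemma galois_kappa a β : IsGaloisInverse (B := B) (a := a) β ->
  β ∘ kappa B a = β.
Proof. intros [E1 E2 E3]. now rewrite <- E1, comp_assoc, E2. Qed.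

(** Uniqueness of inverses in relative form: [β' f = β' k' f = β' f s β = β' s' f β = p' f β = f p β
    = f β]. It gives the naturality, the right linearity and the left colinearity of Galois
    inverses. *)
Lemma inverse_intertwines (c d : A) (s k p β : Hom c c) (s' k' p' β' : Hom d d)
  (f : Hom c d) :
  s ∘ β = k -> p ∘ β = β -> β' ∘ s' = p' -> β' ∘ k' = β' ->
  s' ∘ f = f ∘ s -> k' ∘ f = f ∘ k -> p' ∘ f = f ∘ p -> β' ∘ f = f ∘ β.
Proof.
  intros E1 E2 E3 E4 Es Ek Ep. lhs. rwb E4. rw Ek. rwb E1. rwb Es. rw E3.
  rw Ep. rw E2. close.
Qed.

Lemma galois_natural a b β β' (f : Hom a b) :
  IsGaloisInverse (B := B) (a := a) β ->
  IsGaloisInverse (B := B) (a := b) β' ->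
  β' ∘ ⟨⟨f⟩⟩ = ⟨⟨f⟩⟩ ∘ β.
Proof.
  intros G G'. pose proof (galois_kappa G') as Gk.
  destruct G as [E1 _ E3], G' as [_ F2 _].
  exact (inverse_intertwines E1 E3 F2 Gk (naturality (sigma B) f)
    (naturality (kappa B) f) (balance_natural f)).
Qed.

Lemma galois_Hm a β β' :
  IsGaloisInverse (B := B) (a := a) β ->
  IsGaloisInverse (B := B) (a := H a) β' ->
  β ∘ ⟨m a⟩ = ⟨m a⟩ ∘ β'.
Proof.
  intros G G'. pose proof (galois_kappa G) as Gk.
  destruct G as [_ F2 _], G' as [E1 _ E3].
  exact (inverse_intertwines E1 E3 F2 Gk (sigma_Hm a) (kappa_Hm a)
    (balance_Hm a)).
Qed.

Lemma galois_δH a β : IsGaloisInverse (B := B) (a := a) β ->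
  δ (H a) ∘ β = ⟨β⟩ ∘ δ (H a).
Proof.
  intros G. pose proof (galois_kappa G) as Gk. destruct G as [E1 E2 E3].
  assert (F2 : ⟨β⟩ ∘ ⟨sigma B a⟩ = ⟨balance B a⟩)
    by now rw (f_equal (fmap H) E2).
  assert (Fk : ⟨β⟩ ∘ ⟨kappa B a⟩ = ⟨β⟩)
    by now rw (f_equal (fmap H) Gk).
  exact (eq_sym (inverse_intertwines E1 E3 F2 Fk (eq_sym (δ_sigma a))
    (eq_sym (δ_kappa a)) (eq_sym (δ_balance a)))).
Qed.

(** The second equation is used to replace [S * 1] by [xibar] in the third, so that the conditions
    read [x_1 S(x_2) = xi x], [S(x_1) x_2 = xibar x] and [xibar(x_1) S(x_2) = S x]. *)
Lemma antipode_components (S : NatTrans H H) :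
  IsWeakAntipode (B := B) S <->
  (forall a, m a ∘ ⟨S a⟩ ∘ δ a = xi B a) /\
  (forall a, m a ∘ S (H a) ∘ δ a = xibar B a) /\
  (forall a, m a ∘ ⟨S a⟩ ∘ xibar B (H a) ∘ δ a = S a).
Proof.
  split.
  - intros (S1 & S2 & S3). rewrite S2 in S3.
    split; [| split]; intros a;
      [ apply (f_equal (fun t => component t a)) in S1; simpl in S1; rwb S1
      | apply (f_equal (fun t => component t a)) in S2; simpl in S2; rwb S2
      | apply (f_equal (fun t => component t a)) in S3; simpl in S3; rhs;
        rwb S3; close ]; reflexivity.
  - intros (S1 & S2 & S3).
    assert (E2 : convolution S (idN H) = xibar B).
    { apply NatTrans_ext; intros a. simpl. rwb (S2 a). reflexivity. }
    split; [| split; [exact E2 |]]; [| rewrite E2]; apply NatTrans_ext;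
      intros a; simpl; flat; [flat_exact (S1 a) | flat_exact (S3 a)].
Qed.

Lemma galois_of_antipode : IsWeakBraidedHopfMonad B -> IsGalois B.
Proof.
  intros [S ES] a. apply antipode_components in ES.
  destruct ES as (E1 & E2 & E3).
  exists (⟨m a⟩ ∘ ⟨S (H a)⟩ ∘ δ (H a)). split.
  - rewrite sigmaE, kappa_alt. lhs. rw (naturality δ (m a)).
    rw (naturality δ (S (H a))). rw (comonad_coassoc com (H a)).
    rwb (f_equal (fmap H) (monad_assoc mon a)).
    rw (f_equal (fmap H) (E1 (H a))). close.
  - rewrite sigmaE. unfold balance. lhs. rw (naturality δ (m a)).
    rw (f_equal (fmap H) (naturality S (m a))).
    rw (comonad_coassoc com (H a)).
    rwb (f_equal (fmap H) (monad_assoc mon a)).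
    rw (f_equal (fmap H) (E2 (H a))). close.
  - unfold balance. lhs. rw (naturality δ (m a)).
    rw (f_equal (fmap H) (naturality (xibar B) (m a))).
    rw (naturality δ (S (H a))).
    rw (f_equal (fmap H) (naturality (xibar B) (S (H a)))).
    rw (comonad_coassoc com (H a)).
    rwb (f_equal (fmap H) (monad_assoc mon a)).
    rw (f_equal (fmap H) (E3 (H a))). close.
Qed.

(** Inverses may be chosen object by object, since [galois_natural] holds for any two of them. *)
Lemma galois_nat : IsGalois B ->
  exists β : NatTrans (H ⊙ H) (H ⊙ H),
    forall a, IsGaloisInverse (B := B) (a := a) (β a).
Proof.
  intros G.
  set (β a := proj1_sig (constructive_indefinite_description _ (G a))).
  assert (Gβ : forall a, IsGaloisInverse (B := B) (a := a) (β a)).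
  { intros a. exact (proj2_sig (constructive_indefinite_description _ (G a))). }
  exists (Build_NatTrans (F := H ⊙ H) (G := H ⊙ H) (component := β)
    (fun a b f => galois_natural f (Gβ a) (Gβ b))). exact Gβ.
Qed.

(* The antipode is read off a Galois inverse as [S x = (ε H) β (x ⊗ 1)]. *)
Lemma antipode_of_galois : IsGalois B -> IsWeakBraidedHopfMonad B.
Proof.
  intros G. destruct (galois_nat G) as [β Gβ]. clear G.
  assert (ES : exists S : NatTrans H H,
    forall a, S a = ε (H a) ∘ β a ∘ ⟨e a⟩).
  { exists (Build_NatTrans (F := H) (G := H)
      (component := fun a => ε (H a) ∘ β a ∘ ⟨e a⟩)
      (fun a b f => naturality (compN (compN (whiskerR ε H) β) (whiskerL H e)) f)).
    reflexivity. }
  destruct ES as [S ES].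
  (* Left colinearity of [β] recovers [β(x ⊗ 1)] from its image [S x] under [ε H], as
     [x_1 ⊗ S(x_2)]. *)
  assert (βe : forall a, β a ∘ ⟨e a⟩ = ⟨S a⟩ ∘ δ a).
  { intros a. rhs. rw (ES a). rwb (naturality δ (e a)). rwb (galois_δH (Gβ a)).
    rw (comonad_counitr com (H a)). close. }
  assert (Eπ : forall a, ε (H a) ∘ balance B a = m a ∘ xibar B (H a)).
  { intros a. unfold balance. lhs. rw (naturality ε (m a)).
    rw (naturality ε (xibar B (H a))). rw (comonad_counitl com (H a)). close. }
  assert (E2 : convolution S (idN H) = xibar B).
  { apply NatTrans_ext; intros a. simpl. lhs. rw (ES (H a)).
    rwb (naturality ε (m a)). rwb (galois_Hm (Gβ a) (Gβ (H a))).
    rw (f_equal (fmap H) (monad_unitl mon a)).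
    (* Since [δ x = σ(x ⊗ 1)], the equation [β σ = balance] becomes available. *)
    transitivity (ε (H a) ∘ (β a ∘ sigma B a) ∘ ⟨e a⟩).
    - rewrite sigmaE. rhs. rw (naturality δ (e a)).
      rw (f_equal (fmap H) (monad_unitr mon a)). close.
    - lhs. rw (galois_sect (Gβ a)). rw (Eπ a).
      rw (naturality (xibar B) (e a)). rw (monad_unitr mon a). close. }
  exists S. split; [| split]; [| exact E2 |].
  - apply NatTrans_ext; intros a. simpl. lhs. rwb (βe a). rwb (counit_sigma a).
    rw (galois_retr (Gβ a)). rewrite kappaE. rw (naturality e (⟨e a⟩)).
    rw (naturality (omega B) (e a)).
    rw (f_equal (fmap H) (monad_unitr mon a)).
    unfold R; rewrite xiE. flat. reflexivity.
  - rewrite E2. apply NatTrans_ext; intros a. simpl. lhs.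
    rwb (naturality (xibar B) (S a)). rwb (βe a). rwb (Eπ a).
    rw (galois_balance (Gβ a)). rwb (ES a). close.
Qed.
End Galois.

(** * Invertibility of gamma *)

Section GammaGalois.
Context (A : Category) (B : WeakBraidedBimonad A).
Implicit Types a b : A.
Local Notation H := (wbb_fun B).
Local Notation m := (wbb_m B).
Local Notation "⟨ f ⟩" := (fmap (wbb_fun B) f) (at level 0, format "⟨ f ⟩").

Context (X : @Splitting (FunCat A A) H (xibar B)).
Local Notation ι := (xi_incl X).
Local Notation q := (xi_proj X).

Lemma xi_incl_proj a : ι a ∘ q a = xibar B a.
Proof. exact (f_equal (fun t => component t a) (split_incl_proj X)). Qed.

Lemma xi_proj_incl a : q a ∘ ι a = idm _.
Proof. exact (f_equal (fun t => component t a) (split_proj_incl X)). Qed.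

Lemma xibar_incl a : xibar B a ∘ ι a = ι a.
Proof. lhs. rwb (xi_incl_proj a). rw (xi_proj_incl a). close. Qed.

Lemma xi_proj_xibar a : q a ∘ xibar B a = q a.
Proof. lhs. rwb (xi_incl_proj a). rw (xi_proj_incl a). close. Qed.

Definition balanceN : NatTrans (H ⊙ H) (H ⊙ H) :=
  Build_NatTrans (F := H ⊙ H) (G := H ⊙ H) (component := balance B)
    (fun a b f => balance_natural B f).

Lemma balanced_iff (C : Functor A A) (k : NatTrans (H ⊙ H) C) :
  compN k (rho_rH X) = compN k (Hrho_l X) <->
  forall a, k a ∘ m (H a) ∘ ⟨xibar B (H a)⟩ = k a ∘ ⟨m a⟩ ∘ ⟨xibar B (H a)⟩.
Proof.
  split.
  - intros E a. apply (f_equal (fun t => component t a)) in E.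
    simpl in E. flat_in E.
    rwb (f_equal (fmap H) (xi_incl_proj (H a))). now rw E.
  - intros E. apply NatTrans_ext; intros a. simpl. flat.
    rwb (f_equal (fmap H) (xibar_incl (H a))). now rw (E a).
Qed.

(** A Galois inverse makes [p · σ] itself a coequaliser of the pair; for this choice of coequaliser,
    gamma is the identity. *)
Lemma gamma_iso_of_galois (G : @Splitting (FunCat A A) (H ⊙ H) (kappa B)) :
  IsGalois B -> GammaIsIso X G.
Proof.
  intros HG. destruct (galois_nat HG) as [β Gβ].
  set (i := split_incl G : NatTrans _ _).
  set (p := split_proj G : NatTrans _ _).
  assert (Eip : forall a, i a ∘ p a = kappa B a).
  { intros a. exact (f_equal (fun t => component t a) (split_incl_proj G)). }
  assert (Epi : forall a, p a ∘ i a = idm _).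
  { intros a. exact (f_equal (fun t => component t a) (split_proj_incl G)). }
  assert (Ew : compN (compN p (sigma B)) (rho_rH X)
    = compN (compN p (sigma B)) (Hrho_l X)).
  { apply balanced_iff. intros a. simpl. rewrite <- !(comp_assoc (p a)).
    f_equal. apply sigma_coequalizes. }
  assert (Eu : forall (C : Functor A A) (k : NatTrans (H ⊙ H) C),
    compN k (rho_rH X) = compN k (Hrho_l X) ->
    exists! u : NatTrans (split_obj G) C, compN u (compN p (sigma B)) = k).
  { intros C k Ek. rewrite balanced_iff in Ek.
    exists (compN k (compN β i)). split.
    - apply NatTrans_ext; intros a. simpl. lhs. rw (Eip a).
      rw (galois_kappa (Gβ a)). rw (galois_sect (Gβ a)).
      rw (comp_balance (Ek a)). close.
    - intros u <-. apply NatTrans_ext; intros a. simpl. lhs.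
      rw (galois_retr (Gβ a)). rwb (Eip a). rw (Epi a). rw (Epi a). close. }
  exists (Build_Coequalizer (C := FunCat A A)
    (coeq_obj := split_obj G) (coeq_arr := compN p (sigma B)) Ew Eu).
  exists (idm _). split; [apply comp_idl |].
  exists (idm _). split; apply comp_idl.
Qed.

(** Since [balance] coequalises the pair, it factors through the coequaliser [λ] as [u λ], and
    uniqueness of factorisations gives [λ u = 1]. The Galois inverse is then [u · γ⁻¹ · p]. *)
Lemma galois_of_gamma_iso (G : @Splitting (FunCat A A) (H ⊙ H) (kappa B)) :
  GammaIsIso X G -> IsGalois B.
Proof.
  intros (l & g & Eg & g' & Eg1 & Eg2) a.
  set (i := split_incl G : NatTrans _ _).
  set (p := split_proj G : NatTrans _ _).
  assert (Eip : forall a, i a ∘ p a = kappa B a).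
  { intros b. exact (f_equal (fun t => component t b) (split_incl_proj G)). }
  assert (Eπ : compN balanceN (rho_rH X) = compN balanceN (Hrho_l X)).
  { apply balanced_iff. apply balance_coequalizes. }
  set (λ := coeq_arr l : NatTrans _ _).
  destruct (@coeq_univ _ _ _ _ _ l _ balanceN Eπ) as [u [Eu _]].
  assert (Eλ : @comp (FunCat A A) _ _ _ λ u = idm _).
  { destruct (@coeq_univ _ _ _ _ _ l _ λ (coeq_eq l)) as [w [_ Ew]].
    rewrite <- (Ew (idm _)) by apply comp_idl. symmetry. apply Ew.
    rewrite <- comp_assoc. rewrite Eu. apply NatTrans_ext; intros b.
    apply comp_balance. apply balanced_iff. exact (coeq_eq l). }
  assert (Cg : forall b, g b ∘ λ b = p b ∘ sigma B b).
  { intros b. exact (f_equal (fun t => component t b) Eg). }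
  assert (Cg1 : forall b, g' b ∘ g b = idm _).
  { intros b. exact (f_equal (fun t => component t b) Eg1). }
  assert (Cg2 : forall b, g b ∘ g' b = idm _).
  { intros b. exact (f_equal (fun t => component t b) Eg2). }
  assert (Cu : forall b, u b ∘ λ b = balance B b).
  { intros b. exact (f_equal (fun t => component t b) Eu). }
  assert (Cλ : forall b, λ b ∘ u b = idm _).
  { intros b. exact (f_equal (fun t => component t b) Eλ). }
  exists (u a ∘ g' a ∘ p a). split.
  - lhs. rwb (kappa_sigma B a). rwb (Eip a). rwb (Cg a). rw (Cλ a). rw (Cg2 a).
    rw (Eip a). close.
  - lhs. rwb (Cg a). rw (Cg1 a). rw (Cu a). close.
  - lhs. rwb (Cu a). rw (Cλ a). close.
Qed.
End GammaGalois.

(** * Invertibility of gamma', by duality *)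

Definition cobalance (A : Category) (B : WeakBraidedBimonad A) (a : A) :
  Hom (B (B a)) (B (B a)) :=
  wbb_m B (B a) ∘ fmap B (xibar B (B a)) ∘ fmap B (wbb_δ B a).

Section GammaPrimeGalois.
Context (A : Category) (B : WeakBraidedBimonad A).
Implicit Types a b : A.
Local Notation H := (wbb_fun B).
Local Notation δ := (wbb_δ B).
Local Notation "⟨ f ⟩" := (fmap (wbb_fun B) f) (at level 0, format "⟨ f ⟩").

Lemma balance_op a : balance (opB B) a = cobalance B a :> @Hom A _ _.
Proof.
  unfold balance, cobalance. rewrite xibar_op. simpl. now rewrite comp_assoc.
Qed.

Lemma cogalois_nat : IsGalois (opB B) ->
  exists β : NatTrans (H ⊙ H) (H ⊙ H), forall a,
    β a ∘ sigmabar B a = kappa' B a /\ sigmabar B a ∘ β a = cobalance B a /\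
    kappa' B a ∘ β a = β a.
Proof.
  intros G. destruct (galois_nat G) as [β Gβ].
  exists (Build_NatTrans (F := H ⊙ H) (G := H ⊙ H)
    (component := fun a => β a) (fun a b f => eq_sym (naturality β f))).
  intros a. pose proof (galois_kappa (Gβ a)) as E4.
  destruct (Gβ a) as [E1 E2 E3].
  rewrite balance_op in E2, E3. rewrite kappa_op in E1, E4.
  rewrite sigma_op in E1, E2. auto.
Qed.

Lemma cobalance_comp a b (k : Hom b (H (H a))) :
  ⟨xibar B (H a)⟩ ∘ δ (H a) ∘ k = ⟨xibar B (H a)⟩ ∘ ⟨δ a⟩ ∘ k ->
  cobalance B a ∘ k = k.
Proof.
  intros E. rewrite <- balance_op.
  apply (@comp_balance (op A) (opB B) a b k). rewrite xibar_op. simpl.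
  rewrite !comp_assoc. exact E.
Qed.

Lemma cobalance_equalizes a :
  ⟨xibar B (H a)⟩ ∘ δ (H a) ∘ cobalance B a
    = ⟨xibar B (H a)⟩ ∘ ⟨δ a⟩ ∘ cobalance B a.
Proof.
  pose proof (balance_coequalizes (opB B) a) as E.
  rewrite balance_op, xibar_op in E. simpl in E. rewrite !comp_assoc in E.
  exact E.
Qed.

Lemma sigmabar_equalizes a :
  ⟨xibar B (H a)⟩ ∘ δ (H a) ∘ sigmabar B a
    = ⟨xibar B (H a)⟩ ∘ ⟨δ a⟩ ∘ sigmabar B a.
Proof.
  pose proof (sigma_coequalizes (opB B) a) as E.
  rewrite sigma_op, xibar_op in E. simpl in E. rewrite !comp_assoc in E.
  exact E.
Qed.

Lemma sigmabar_kappa' a : sigmabar B a ∘ kappa' B a = sigmabar B a.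
Proof. dual_exact (kappa_sigma (opB B) a). Qed.

Definition cobalanceN : NatTrans (H ⊙ H) (H ⊙ H) :=
  Build_NatTrans (F := H ⊙ H) (G := H ⊙ H) (component := cobalance B)
    (fun a b f =>
       eq_trans (f_equal (fun t => t ∘ ⟨⟨f⟩⟩) (eq_sym (balance_op b)))
         (eq_trans (eq_sym (balance_natural (opB B) f))
            (f_equal (comp ⟨⟨f⟩⟩) (balance_op a)))).

Context (X : @Splitting (FunCat A A) H (xibar B)).

Lemma cobalanced_iff (C : Functor A A) (k : NatTrans C (H ⊙ H)) :
  compN (theta_rH X) k = compN (Htheta_l X) k <->
  forall a, ⟨xibar B (H a)⟩ ∘ δ (H a) ∘ k a = ⟨xibar B (H a)⟩ ∘ ⟨δ a⟩ ∘ k a.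
Proof.
  split.
  - intros E a. apply (f_equal (fun t => component t a)) in E.
    simpl in E. flat_in E.
    rwb (f_equal (fmap H) (xi_incl_proj X (H a))). now rw E.
  - intros E. apply NatTrans_ext; intros a. simpl. flat.
    rwb (f_equal (fmap H) (xi_proj_xibar X (H a))). now rw (E a).
Qed.

(** Pointwise equations are imported from the opposite bimonad, but the equaliser lives in
    endofunctors of [A], not of [op A]; its universal property is therefore verified directly, as
    for gamma. *)
Lemma gamma'_iso_of_cogalois
  (T : @Splitting (FunCat A A) (H ⊙ H) (kappa' B)) :
  IsGalois (opB B) -> GammaPrimeIsIso X T.
Proof.
  intros HG. destruct (cogalois_nat HG) as [β Gβ].
  set (i := split_incl T : NatTrans _ _).
  set (p := split_proj T : NatTrans _ _).
  assert (Eip : forall a, i a ∘ p a = kappa' B a).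
  { intros a. exact (f_equal (fun t => component t a) (split_incl_proj T)). }
  assert (Epi : forall a, p a ∘ i a = idm _).
  { intros a. exact (f_equal (fun t => component t a) (split_proj_incl T)). }
  assert (Ew : compN (theta_rH X) (compN (sigmabar B) i)
    = compN (Htheta_l X) (compN (sigmabar B) i)).
  { apply cobalanced_iff. intros a. simpl. rewrite !(comp_assoc _ _ (i a)).
    apply comp_tail. apply sigmabar_equalizes. }
  assert (Eu : forall (C : Functor A A) (k : NatTrans C (H ⊙ H)),
    compN (theta_rH X) k = compN (Htheta_l X) k ->
    exists! u : NatTrans C (split_obj T), compN (compN (sigmabar B) i) u = k).
  { intros C k Ek. rewrite cobalanced_iff in Ek.
    exists (compN p (compN β k)). split.
    - apply NatTrans_ext; intros a. destruct (Gβ a) as (G1 & G2 & G3).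
      simpl. lhs. rw (Eip a). rw G3. rw G2. rw (cobalance_comp (Ek a)). close.
    - intros u <-. apply NatTrans_ext; intros a.
      destruct (Gβ a) as (G1 & _ & _). simpl. lhs.
      rw G1. rwb (Eip a). rw (Epi a). rw (Epi a). close. }
  exists (Build_Equalizer (C := FunCat A A)
    (eq_obj := split_obj T) (eq_arr := compN (sigmabar B) i) Ew Eu).
  exists (idm _). split; [apply comp_idr |].
  exists (idm _). split; apply comp_idl.
Qed.

Lemma cogalois_of_gamma'_iso
  (T : @Splitting (FunCat A A) (H ⊙ H) (kappa' B)) :
  GammaPrimeIsIso X T -> IsGalois (opB B).
Proof.
  intros (l & g & Eg & g' & Eg1 & Eg2) a.
  set (i := split_incl T : NatTrans _ _).
  set (p := split_proj T : NatTrans _ _).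
  assert (Eip : forall a, i a ∘ p a = kappa' B a).
  { intros b. exact (f_equal (fun t => component t b) (split_incl_proj T)). }
  assert (Eπ : compN (theta_rH X) cobalanceN = compN (Htheta_l X) cobalanceN).
  { apply cobalanced_iff. apply cobalance_equalizes. }
  set (λ := eq_arr l : NatTrans _ _).
  destruct (@eq_univ _ _ _ _ _ l _ cobalanceN Eπ) as [u [Eu _]].
  assert (Eλ : @comp (FunCat A A) _ _ _ u λ = idm _).
  { destruct (@eq_univ _ _ _ _ _ l _ λ (eq_eq l)) as [w [_ Ew]].
    rewrite <- (Ew (idm _)) by apply comp_idr. symmetry. apply Ew.
    rewrite comp_assoc. rewrite Eu. apply NatTrans_ext; intros b.
    apply cobalance_comp. apply cobalanced_iff. exact (eq_eq l). }
  assert (Cg : forall b, λ b ∘ g b = sigmabar B b ∘ i b).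
  { intros b. exact (f_equal (fun t => component t b) Eg). }
  assert (Cg1 : forall b, g' b ∘ g b = idm _).
  { intros b. exact (f_equal (fun t => component t b) Eg1). }
  assert (Cg2 : forall b, g b ∘ g' b = idm _).
  { intros b. exact (f_equal (fun t => component t b) Eg2). }
  assert (Cu : forall b, λ b ∘ u b = cobalance B b).
  { intros b. exact (f_equal (fun t => component t b) Eu). }
  assert (Cλ : forall b, u b ∘ λ b = idm _).
  { intros b. exact (f_equal (fun t => component t b) Eλ). }
  assert (G1 : (i a ∘ g' a ∘ u a) ∘ sigmabar B a = kappa' B a).
  { lhs. rwb (sigmabar_kappa' a). rwb (Eip a). rwb (Cg a). rw (Cλ a).
    rw (Cg1 a). rw (Eip a). close. }
  assert (G2 : sigmabar B a ∘ (i a ∘ g' a ∘ u a) = cobalance B a).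
  { lhs. rwb (Cg a). rw (Cg2 a). rw (Cu a). close. }
  assert (G3 : (i a ∘ g' a ∘ u a) ∘ cobalance B a = i a ∘ g' a ∘ u a).
  { lhs. rwb (Cu a). rw (Cλ a). close. }
  exists (i a ∘ g' a ∘ u a). split.
  - rewrite kappa_op, sigma_op. exact G1.
  - rewrite balance_op, sigma_op. exact G2.
  - rewrite balance_op. exact G3.
Qed.
End GammaPrimeGalois.

(** * Self-duality of the weak antipode *)

Section HopfOp.
Context (A : Category) (B : WeakBraidedBimonad A).
Implicit Types a b : A.
Local Notation H := (wbb_fun B).

Lemma antipode_op (S : NatTrans H H) :
  IsWeakAntipode (B := B) S -> IsWeakAntipode (B := opB B) (opN S).
Proof.
  intros ES. apply antipode_components in ES. destruct ES as (E1 & E2 & E3).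
  apply antipode_components. split; [| split]; intros a.
  - rewrite xi_op. simpl. rewrite <- (E1 a). apply comp_assoc.
  - rewrite xibar_op. simpl. rewrite <- (E2 a). apply comp_assoc.
  - rewrite xibar_op. simpl. rhs. rwb (E3 a). rwb (naturality (xibar B) (S a)).
    close.
Qed.

(** The converse is not an instance of [antipode_op], because [op (op A)] agrees with [A] only up to
    its proofs of associativity. *)
Lemma hopf_op : IsWeakBraidedHopfMonad B <-> IsWeakBraidedHopfMonad (opB B).
Proof.
  split; intros [S ES].
  - exists (opN S). now apply antipode_op.
  - apply antipode_components in ES. destruct ES as (E1 & E2 & E3).
    set (S' := Build_NatTrans (F := H) (G := H)
      (component := fun a => S a) (fun a b f => eq_sym (naturality S f))).
    exists S'. apply antipode_components. split; [| split]; intros a.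
    + specialize (E1 a). rewrite xi_op in E1.
      rewrite <- comp_assoc. exact E1.
    + specialize (E2 a). rewrite xibar_op in E2.
      rewrite <- comp_assoc. exact E2.
    + specialize (E3 a). rewrite xibar_op in E3.
      lhs. rwb (naturality (xibar B) (S' a)). unfold R. exact E3.
Qed.
End HopfOp.

(** * Separable adjunctions *)

Definition FullyFaithful (C D : Category) (F : Functor C D) : Prop :=
  forall (a b : C) (g : Hom (F a) (F b)), exists! f : Hom a b, fmap F f = g.

Definition EssentiallySurjective (C D : Category) (F : Functor C D) : Prop :=
  forall d : D, exists (c : C) (f : Hom (F c) d), IsIso f.

Section Equivalences.
Context (C D : Category) (F : Functor C D).

Lemma fully_faithful_of_equivalence : IsEquivalence F -> FullyFaithful F.
Proof.
  intros (G & (η & η' & E1 & E2) & (θ & θ' & E3 & E4)).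
  assert (C1 : forall a, η' a ∘ η a = idm _)
    by (intros a; exact (f_equal (fun t => component t a) E1)).
  assert (C2 : forall a, η a ∘ η' a = idm _)
    by (intros a; exact (f_equal (fun t => component t a) E2)).
  assert (C3 : forall a, θ' a ∘ θ a = idm _)
    by (intros a; exact (f_equal (fun t => component t a) E3)).
  assert (C4 : forall a, θ a ∘ θ' a = idm _)
    by (intros a; exact (f_equal (fun t => component t a) E4)).
  assert (GF : forall (a b : D) (g g' : Hom a b), fmap G g = fmap G g' -> g = g').
  { intros a b g g' E. apply (f_equal (fmap F)) in E.
    pose proof (naturality θ g) as N. pose proof (naturality θ g') as N'.
    simpl in N, N'. rewrite E in N. rewrite N in N'.
    apply (f_equal (fun t => t ∘ θ' a)) in N'. rewrite <- !comp_assoc, C4 in N'.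
    now rewrite !comp_idr in N'. }
  intros a b g. exists (η' b ∘ fmap G g ∘ η a). split.
  - apply GF. set (f := η' b ∘ fmap G g ∘ η a).
    transitivity (fmap G (fmap F f) ∘ η a ∘ η' a); [now rw (C2 a) |].
    lhs. rwb (naturality η f). unfold f. rw (C2 b). rw (C2 a). close.
  - intros f <-. lhs. rwb (naturality η f). rw (C1 b). close.
Qed.

Hypothesis (FF : FullyFaithful F).

Lemma fully_faithful_lift (a b : C) (g : Hom (F a) (F b)) :
  {f : Hom a b | fmap F f = g}.
Proof.
  apply constructive_indefinite_description.
  destruct (FF g) as [f [E _]]. now exists f.
Qed.

Lemma fully_faithful_inj (a b : C) (f f' : Hom a b) :
  fmap F f = fmap F f' -> f = f'.
Proof.
  intros E. destruct (FF (fmap F f')) as [f0 [_ E0]].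
  now rewrite <- (E0 f E), <- (E0 f').
Qed.

Lemma equivalence_of_fully_faithful : EssentiallySurjective F -> IsEquivalence F.
Proof.
  intros ES.
  assert (ch : forall d, {c : C & {f : Hom (F c) d & {g : Hom d (F c) |
    g ∘ f = idm _ /\ f ∘ g = idm _}}}).
  { intros d.
    destruct (constructive_indefinite_description _ (ES d)) as [c Ec].
    destruct (constructive_indefinite_description _ Ec) as [f Ef].
    destruct (constructive_indefinite_description _ Ef) as [g Eg].
    now exists c, f, g. }
  set (G0 d := projT1 (ch d)).
  set (θ d := projT1 (projT2 (ch d)) : Hom (F (G0 d)) d).
  set (θ' d := proj1_sig (projT2 (projT2 (ch d))) : Hom d (F (G0 d))).
  assert (C1 : forall d, θ' d ∘ θ d = idm _)
    by (intros d; exact (proj1 (proj2_sig (projT2 (projT2 (ch d)))))).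
  assert (C2 : forall d, θ d ∘ θ' d = idm _)
    by (intros d; exact (proj2 (proj2_sig (projT2 (projT2 (ch d)))))).
  clearbody θ θ'. clearbody G0.
  set (G1 d d' (g : Hom d d') :=
    proj1_sig (fully_faithful_lift (θ' d' ∘ g ∘ θ d))).
  assert (EG : forall d d' (g : Hom d d'), fmap F (G1 d d' g) = θ' d' ∘ g ∘ θ d)
    by (intros; exact (proj2_sig (fully_faithful_lift _))).
  clearbody G1.
  unshelve eset (G := {| fobj := G0; fmap := G1 |} : Functor D C).
  { intros d. apply fully_faithful_inj. rewrite EG, fmap_id, comp_idr. apply C1. }
  { intros d d' d'' g f. apply fully_faithful_inj. rewrite fmap_comp, !EG.
    rhs. rw (C2 d'). close. }
  exists G. split.
  - set (η c := proj1_sig (fully_faithful_lift (θ' (F c)))).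
    assert (Eη : forall c, fmap F (η c) = θ' (F c))
      by (intros; exact (proj2_sig (fully_faithful_lift _))).
    set (η' c := proj1_sig (fully_faithful_lift (θ (F c)))).
    assert (Eη' : forall c, fmap F (η' c) = θ (F c))
      by (intros; exact (proj2_sig (fully_faithful_lift _))).
    clearbody η η'.
    unshelve eexists (Build_NatTrans (F := idF C) (G := G ⊙ F)
      (component := η) _).
    { intros a b f. apply fully_faithful_inj. simpl.
      rewrite !fmap_comp, EG, !Eη. rhs. rw (C2 (F a)). close. }
    unshelve eexists (Build_NatTrans (F := G ⊙ F) (G := idF C)
      (component := η') _).
    { intros a b f. apply fully_faithful_inj. simpl.
      rewrite !fmap_comp, EG, !Eη'. lhs. rw (C2 (F b)). close. }
    split; apply NatTrans_ext; intros a; apply fully_faithful_inj; simpl;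
      rewrite fmap_comp, Eη, Eη', fmap_id; auto.
  - unshelve eexists (Build_NatTrans (F := F ⊙ G) (G := idF D)
      (component := θ) _).
    { intros a b f. simpl. rewrite EG. lhs. rw (C2 b). close. }
    unshelve eexists (Build_NatTrans (F := idF D) (G := F ⊙ G)
      (component := θ') _).
    { intros a b f. simpl. rewrite EG. rhs. rw (C2 a). close. }
    split; apply NatTrans_ext; intros a; simpl; auto.
Qed.
End Equivalences.

Lemma equivalence_sym (C D : Category) (F : Functor C D) :
  IsEquivalence F -> EquivalentCategories D C.
Proof.
  intros (G & (η & η' & E1 & E2) & (θ & θ' & E3 & E4)).
  exists G, F. split; [exists θ', θ | exists η', η]; auto.
Qed.

Section SeparableMonadic.
Context (C D : Category) (F : Functor C D) (U : Functor D C)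
  (adj : Adjunction F U).
Local Notation η := (adj_unit adj).
Local Notation ε := (adj_counit adj).

(* A section of the counit that is natural on the whole of [D] makes [U]
   separable, hence monadic as soon as idempotents split in [D]. *)
Lemma separable_monadic (u : NatTrans (idF D) (F ⊙ U)) :
  CauchyComplete D -> (forall d, ε d ∘ u d = idm d) ->
  FullyFaithful (monadic_comparison adj) /\
  EssentiallySurjective (monadic_comparison adj).
Proof.
  intros HD Eu. split.
  - intros d d' [t Ht]. simpl in t, Ht. red in Ht. simpl in Ht.
    exists (ε d' ∘ fmap F t ∘ u d). split.
    + apply ModuleHom_ext. simpl. lhs. rwb Ht.
      rw (f_equal (fmap U) (Eu d)). close.
    + intros f Ef. apply (f_equal (@mod_hom _ _ _ _)) in Ef. simpl in Ef.
      subst t. lhs. rw (naturality ε f). rw (Eu d). close.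
  - intros [N n [Ha Hu]]. simpl in n, Ha, Hu.
    (* The object over the module [(N, n)] is the image of the idempotent [F n · u] on [F N]. Since
       this idempotent coequalises [F n] and the counit, its image serves as their coequaliser. *)
    assert (P1 : fmap F n ∘ u (F N) ∘ fmap F n = fmap F n ∘ u (F N) ∘ ε (F N)).
    { lhs. rw (naturality u (fmap F n)). rw (f_equal (fmap F) Ha).
      rwb (naturality u (ε (F N))). close. }
    assert (P2 : (fmap F n ∘ u (F N)) ∘ (fmap F n ∘ u (F N)) = fmap F n ∘ u (F N)).
    { lhs. rw P1. rw (Eu (F N)). close. }
    destruct (HD _ _ P2) as [[d i p Eip Epi]].
    assert (P3 : p ∘ fmap F n = p ∘ ε (F N)).
    { transitivity (p ∘ (i ∘ p) ∘ fmap F n); [rhs; rw Epi; close |].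
      rewrite Eip. lhs. rw P1. unfold R. clear R. rhs.
      transitivity (p ∘ (i ∘ p) ∘ ε (F N)); [rhs; rw Epi; close |].
      rewrite Eip. close. }
    assert (J1 : (n ∘ fmap U i) ∘ (fmap U p ∘ η N) = idm N).
    { lhs. rw (f_equal (fmap U) Eip). rw Ha.
      rw (f_equal (fmap U) (Eu (F N))). rw Hu. close. }
    assert (J2 : (fmap U p ∘ η N) ∘ (n ∘ fmap U i) = idm (U d)).
    { lhs. rw (naturality η n). rw (f_equal (fmap U) P3).
      rw (adj_triangle_right adj (F N)). rw (f_equal (fmap U) Epi). close. }
    assert (J3 : (n ∘ fmap U i) ∘ fmap U (ε d)
      = n ∘ fmap U (fmap F (n ∘ fmap U i))).
    { lhs. rwb (f_equal (fmap U) (naturality ε i)). rwb Ha. close. }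
    assert (J4 : (fmap U p ∘ η N) ∘ n
      = fmap U (ε d) ∘ fmap U (fmap F (fmap U p ∘ η N))).
    { lhs. rw (naturality η n). rw (f_equal (fmap U) P3).
      rw (adj_triangle_right adj (F N)). unfold R; clear R. rhs.
      rw (f_equal (fmap U) (naturality ε p)).
      rw (f_equal (fmap U) (adj_triangle_left adj N)). close. }
    exists d.
    exists (@Build_ModuleHom C (adj_monad adj) (monadic_comparison adj d)
      (Build_Module (T := adj_monad adj) (Build_IsModule (T := adj_monad adj) Ha Hu))
      (n ∘ fmap U i) J3).
    exists (@Build_ModuleHom C (adj_monad adj)
      (Build_Module (T := adj_monad adj) (Build_IsModule (T := adj_monad adj) Ha Hu))
      (monadic_comparison adj d) (fmap U p ∘ η N) J4).
    split; apply ModuleHom_ext; assumption.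
Qed.

(** Here the section is natural only between free objects. The map [z] stands for the composite of
    the counit at [d] with the desired [t]: it coequalises the pair formed by [ε (F (U d))] and
    [F (U (ε d))]. Its transpose is a module morphism, and full faithfulness lifts that to [t]. *)
Lemma counit_section (s : forall a, Hom (F a) (F (U (F a)))) :
  FullyFaithful (monadic_comparison adj) ->
  (forall a, ε (F a) ∘ s a = idm _) ->
  (forall a b (f : Hom (F b) (F a)), s a ∘ f = fmap F (fmap U f) ∘ s b) ->
  forall d, exists t : Hom d (F (U d)), ε d ∘ t = idm d.
Proof.
  intros FF Es Ns d.
  set (z := fmap F (fmap U (ε d)) ∘ s (U d)).
  assert (Z : z ∘ ε (F (U d)) = z ∘ fmap F (fmap U (ε d))).
  { unfold z. lhs. rw (Ns _ _ (ε (F (U d)))). unfold R; clear R. rhs.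
    rw (Ns _ _ (fmap F (fmap U (ε d)))).
    rw (f_equal (fmap F) (f_equal (fmap U) (naturality ε (ε d)))). close. }
  assert (Ht : IsModuleHom (T := adj_monad adj)
    (mod_act (monadic_comparison adj d))
    (mod_act (monadic_comparison adj (F (U d)))) (fmap U z ∘ η (U d))).
  { red. simpl. lhs. rw (naturality η (fmap U (ε d))).
    rwb (f_equal (fmap U) Z). rw (adj_triangle_right adj (F (U d))).
    unfold R; clear R. rhs. rw (f_equal (fmap U) (naturality ε z)).
    rw (f_equal (fmap U) (adj_triangle_left adj (U d))). close. }
  destruct (FF _ _ (@Build_ModuleHom C (adj_monad adj)
    (monadic_comparison adj d) (monadic_comparison adj (F (U d))) _ Ht))
    as [t [Et _]].
  apply (f_equal (@mod_hom _ _ _ _)) in Et. simpl in Et.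
  exists t. apply (fully_faithful_inj FF). apply ModuleHom_ext. simpl.
  lhs. rw Et. unfold z.
  rw (f_equal (fmap U) (naturality ε (ε d))).
  rw (f_equal (fmap U) (Es (U d))). rw (adj_triangle_right adj d). close.
Qed.
End SeparableMonadic.

Section CoseparableComonadic.
Context (C D : Category) (F : Functor C D) (U : Functor D C)
  (adj : Adjunction F U).
Local Notation η := (adj_unit adj).
Local Notation ε := (adj_counit adj).

(** Dual to [separable_monadic]: the object over a comodule [(N, n)] is the image of the idempotent
    [u · U n] on [U N]. *)
Lemma coseparable_comonadic (u : NatTrans (U ⊙ F) (idF C)) :
  CauchyComplete C -> (forall c, u c ∘ η c = idm c) ->
  FullyFaithful (comonadic_comparison adj) /\
  EssentiallySurjective (comonadic_comparison adj).
Proof.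
  intros HC Eu. split.
  - intros d d' [t Ht]. simpl in t, Ht. red in Ht. simpl in Ht.
    exists (u d' ∘ fmap U t ∘ η d). split.
    + apply ComoduleHom_ext. simpl. lhs. rwb Ht.
      rw (f_equal (fmap F) (Eu d')). close.
    + intros f Ef. apply (f_equal (@comod_hom _ _ _ _)) in Ef. simpl in Ef.
      subst t. lhs. rwb (naturality η f). rw (Eu d'). close.
  - intros [N n [Ha Hu]]. simpl in n, Ha, Hu.
    assert (P1 : fmap U n ∘ u (U N) ∘ fmap U n = η (U N) ∘ u (U N) ∘ fmap U n).
    { lhs. rwb (naturality u (fmap U n)). rw (f_equal (fmap U) Ha).
      rw (naturality u (η (U N))). close. }
    assert (P2 : (u (U N) ∘ fmap U n) ∘ (u (U N) ∘ fmap U n) = u (U N) ∘ fmap U n).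
    { lhs. rw P1. rw (Eu (U N)). close. }
    destruct (HC _ _ P2) as [[c i p Eip Epi]].
    assert (P3 : fmap U n ∘ i = η (U N) ∘ i).
    { transitivity (fmap U n ∘ (i ∘ p) ∘ i); [rhs; rw Epi; close |].
      rewrite Eip. lhs. rw P1. unfold R. clear R. rhs.
      transitivity (η (U N) ∘ (i ∘ p) ∘ i); [rhs; rw Epi; close |].
      rewrite Eip. close. }
    assert (J1 : (ε N ∘ fmap F i) ∘ (fmap F p ∘ n) = idm N).
    { lhs. rw (f_equal (fmap F) Eip). rw Ha.
      rw (f_equal (fmap F) (Eu (U N))). rw Hu. close. }
    assert (J2 : (fmap F p ∘ n) ∘ (ε N ∘ fmap F i) = idm (F c)).
    { lhs. rwb (naturality ε n). rw (f_equal (fmap F) P3).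
      rw (adj_triangle_left adj (U N)). rw (f_equal (fmap F) Epi). close. }
    assert (J3 : n ∘ (ε N ∘ fmap F i)
      = fmap F (fmap U (ε N ∘ fmap F i)) ∘ fmap F (η c)).
    { lhs. rwb (naturality ε n). rw (f_equal (fmap F) P3).
      rw (adj_triangle_left adj (U N)). unfold R; clear R. rhs.
      rwb (f_equal (fmap F) (naturality η i)).
      rw (f_equal (fmap F) (adj_triangle_right adj N)). close. }
    assert (J4 : fmap F (η c) ∘ (fmap F p ∘ n)
      = fmap F (fmap U (fmap F p ∘ n)) ∘ n).
    { lhs. rw (f_equal (fmap F) (naturality η p)). rwb Ha. close. }
    exists c.
    exists (@Build_ComoduleHom D (adj_comonad adj) (comonadic_comparison adj c)
      (Build_Comodule (T := adj_comonad adj)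
        (Build_IsComodule (T := adj_comonad adj) Ha Hu))
      (ε N ∘ fmap F i) J3).
    exists (@Build_ComoduleHom D (adj_comonad adj)
      (Build_Comodule (T := adj_comonad adj)
        (Build_IsComodule (T := adj_comonad adj) Ha Hu))
      (comonadic_comparison adj c) (fmap F p ∘ n) J4).
    split; apply ComoduleHom_ext; assumption.
Qed.

Lemma unit_retraction (s : forall a, Hom (U (F (U a))) (U a)) :
  FullyFaithful (comonadic_comparison adj) ->
  (forall a, s a ∘ η (U a) = idm _) ->
  (forall a b (f : Hom (U b) (U a)), f ∘ s b = s a ∘ fmap U (fmap F f)) ->
  forall c, exists t : Hom (U (F c)) c, t ∘ η c = idm c.
Proof.
  intros FF Es Ns c.
  set (z := s (F c) ∘ fmap U (fmap F (η c))).
  assert (Z : η (U (F c)) ∘ z = fmap U (fmap F (η c)) ∘ z).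
  { unfold z. lhs. rw (Ns _ _ (η (U (F c)))). unfold R; clear R. rhs.
    rw (Ns _ _ (fmap U (fmap F (η c)))).
    rwb (f_equal (fmap U) (f_equal (fmap F) (naturality η (η c)))). close. }
  assert (Ht : IsComoduleHom (T := adj_comonad adj)
    (comod_coact (comonadic_comparison adj (U (F c))))
    (comod_coact (comonadic_comparison adj c)) (ε (F c) ∘ fmap F z)).
  { red. simpl. lhs. rwb (naturality ε (fmap F (η c))).
    rwb (f_equal (fmap F) Z). rw (adj_triangle_left adj (U (F c))).
    unfold R; clear R. rhs. rwb (f_equal (fmap F) (naturality η z)).
    rw (f_equal (fmap F) (adj_triangle_right adj (F c))). close. }
  destruct (FF _ _ (@Build_ComoduleHom D (adj_comonad adj)
    (comonadic_comparison adj (U (F c))) (comonadic_comparison adj c) _ Ht))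
    as [t [Et _]].
  apply (f_equal (@comod_hom _ _ _ _)) in Et. simpl in Et.
  exists t. apply (fully_faithful_inj FF). apply ComoduleHom_ext. simpl.
  lhs. rw Et. unfold z.
  rwb (f_equal (fmap F) (naturality η (η c))).
  rw (f_equal (fmap F) (Es (F c))). rw (adj_triangle_left adj c). close.
Qed.
End CoseparableComonadic.

(* This is what separability of the monad [Hxi] provides for [K_omega]. *)
Record SeparabilityData (C D : Category) (F : Functor C D) : Type := {
  sep_obj : C -> C;
  sep_mul : forall a, Hom (F (sep_obj a)) (F a);
  sep_comul : forall a, Hom (F a) (F (sep_obj a));
  sep_retract : forall a, sep_mul a ∘ sep_comul a = idm (F a);
  sep_natural : forall a b (f : Hom (F b) (F a)),
    exists g : Hom (sep_obj b) (sep_obj a),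
      f ∘ sep_mul b = sep_mul a ∘ fmap F g /\
      fmap F g ∘ sep_comul b = sep_comul a ∘ f
}.

Lemma separable_counit_section (C D : Category) (F : Functor C D)
  (U : Functor D C) (adj : Adjunction F U) (P : SeparabilityData F) :
  Monadic adj -> forall d, exists t, adj_counit adj d ∘ t = idm d.
Proof.
  intros HM. apply fully_faithful_of_equivalence in HM.
  destruct P as [h ρ θ Eρθ N].
  (* The transpose of the multiplication [ρ] compares the base with the monad of the unknown
     adjunction; composing with [F j] turns the splitting [θ] of [ρ] into a section of the counit at
     [F a]. *)
  set (j a := fmap U (ρ a) ∘ adj_unit adj (h a) : Hom (h a) (U (F a))).
  assert (Ej : forall a, adj_counit adj (F a) ∘ fmap F (j a) = ρ a).
  { intros a. unfold j. lhs. rw (naturality (adj_counit adj) (ρ a)).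
    rw (adj_triangle_left adj (h a)). close. }
  apply (counit_section (s := fun a => fmap F (j a) ∘ θ a) HM).
  - intros a. lhs. rw (Ej a). rw (Eρθ a). close.
  - intros a b f. destruct (N a b f) as (g & E1 & E2).
    assert (E : j a ∘ g = fmap U f ∘ j b).
    { unfold j. lhs. rw (naturality (adj_unit adj) g).
      rwb (f_equal (fmap U) E1). close. }
    lhs. rwb E2. rw (f_equal (fmap F) E). close.
Qed.

Lemma separable_unit_retraction (C D : Category) (L : Functor D C)
  (F : Functor C D) (adj : Adjunction L F) (P : SeparabilityData F) :
  Comonadic adj -> forall d, exists t, t ∘ adj_unit adj d = idm d.
Proof.
  intros HM. apply fully_faithful_of_equivalence in HM.
  destruct P as [h ρ θ Eρθ N].
  set (j a := adj_counit adj (h a) ∘ fmap L (θ a) : Hom (L (F a)) (h a)).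
  assert (Ej : forall a, fmap F (j a) ∘ adj_unit adj (F a) = θ a).
  { intros a. unfold j. lhs. rwb (naturality (adj_unit adj) (θ a)).
    rw (adj_triangle_right adj (h a)). close. }
  apply (unit_retraction (s := fun a => ρ a ∘ fmap F (j a)) HM).
  - intros a. lhs. rw (Ej a). rw (Eρθ a). close.
  - intros a b f. destruct (N a b f) as (g & E1 & E2).
    assert (E : g ∘ j b = j a ∘ fmap L f).
    { unfold j. lhs. rwb (naturality (adj_counit adj) g).
      rw (f_equal (fmap L) E2). close. }
    lhs. rw E1. rw (f_equal (fmap F) E). close.
Qed.

(** * Mixed bimodules *)

Section MixedSplit.
Context (A : Category) (B : WeakBraidedBimonad A).
Implicit Types a b : A.
Local Notation H := (wbb_fun B).
Local Notation m := (wbb_m B).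
Local Notation e := (wbb_e B).
Local Notation δ := (wbb_δ B).
Local Notation ε := (wbb_ε B).
Local Notation "⟨ f ⟩" := (fmap (wbb_fun B) f) (at level 0, format "⟨ f ⟩").

Context (x y : A) (h : Hom (H x) x) (θ : Hom x (H x))
  (i : Hom y x) (p : Hom x y).
Hypotheses (h_assoc : h ∘ ⟨h⟩ = h ∘ m x)
  (θ_coassoc : ⟨θ⟩ ∘ θ = δ x ∘ θ) (θ_counit : ε x ∘ θ = idm x)
  (h_θ : θ ∘ h = ⟨h⟩ ∘ omega B x ∘ ⟨θ⟩)
  (h_ip : i ∘ p ∘ h = h ∘ ⟨i⟩ ∘ ⟨p⟩)
  (θ_ip : θ ∘ i ∘ p = ⟨i⟩ ∘ ⟨p⟩ ∘ θ)
  (p_i : p ∘ i = idm y) (h_unit : p ∘ h ∘ e x ∘ i = idm y).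

(* The action [h] need not be unital; it becomes so on [y]. *)
Lemma split_isModule : @IsModule A (wbb_monad B) y (p ∘ h ∘ ⟨i⟩).
Proof.
  split; simpl.
  - lhs. rw (f_equal (fmap H) h_ip). rw h_assoc. rw (naturality m i).
    rw (f_equal (fmap H) (f_equal (fmap H) p_i)). close.
  - lhs. rwb (naturality e i). rw h_unit. close.
Qed.

Lemma split_isComodule : @IsComodule A (wbb_comonad B) y (⟨p⟩ ∘ θ ∘ i).
Proof.
  split; simpl.
  - lhs. rw (f_equal (fmap H) θ_ip).
    rw (f_equal (fmap H) (f_equal (fmap H) p_i)). rw θ_coassoc.
    rwb (naturality δ p). close.
  - lhs. rw (naturality ε p). rw θ_counit. rw p_i. close.
Qed.

Lemma split_compat :
  (⟨p⟩ ∘ θ ∘ i) ∘ (p ∘ h ∘ ⟨i⟩)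
    = ⟨p ∘ h ∘ ⟨i⟩⟩ ∘ omega B y ∘ ⟨⟨p⟩ ∘ θ ∘ i⟩.
Proof.
  lhs. rw θ_ip. rw (f_equal (fmap H) p_i). rw h_θ. unfold R; clear R. rhs.
  rwb (naturality (omega B) i). rwb (f_equal (fmap H) θ_ip).
  rw (f_equal (fmap H) p_i). close.
Qed.

(** Serves twice: to split idempotents of mixed bimodules, and to cut the cofree bimodule out of
    [H (H a)], where unitality is to be enforced. *)
Definition mixed_split : MixedBimodule B :=
  Build_MixedBimodule split_isModule split_isComodule split_compat.
End MixedSplit.

Section MixedLaws.
Context (A : Category) (B : WeakBraidedBimonad A).
Implicit Types a b : A.
Local Notation m := (wbb_m B).
Local Notation e := (wbb_e B).
Local Notation δ := (wbb_δ B).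
Local Notation ε := (wbb_ε B).
Local Notation "⟨ f ⟩" := (fmap (wbb_fun B) f) (at level 0, format "⟨ f ⟩").

Context (M : MixedBimodule B).

Lemma mix_assoc : mix_act M ∘ ⟨mix_act M⟩ = mix_act M ∘ m (mix_obj M).
Proof. exact (module_assoc (mix_isModule M)). Qed.
Lemma mix_unit : mix_act M ∘ e (mix_obj M) = idm _.
Proof. exact (module_unit (mix_isModule M)). Qed.
Lemma mix_coassoc : ⟨mix_coact M⟩ ∘ mix_coact M = δ (mix_obj M) ∘ mix_coact M.
Proof. exact (comodule_coassoc (mix_isComodule M)). Qed.
Lemma mix_counit : ε (mix_obj M) ∘ mix_coact M = idm _.
Proof. exact (comodule_counit (mix_isComodule M)). Qed.
End MixedLaws.

Lemma mixed_cauchy (A : Category) (B : WeakBraidedBimonad A) :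
  CauchyComplete A -> CauchyComplete (MixedBimod B).
Proof.
  intros HA M [f Hf Cf] Ef. red in Hf, Cf.
  apply (f_equal (@mix_hom _ _ _ _)) in Ef. simpl in Ef.
  destruct (HA _ _ Ef) as [[y i p Eip Epi]].
  assert (Hip : i ∘ p ∘ mix_act M = mix_act M ∘ fmap B i ∘ fmap B p).
  { rewrite Eip, <- comp_assoc, <- fmap_comp, Eip. exact Hf. }
  assert (Cip : mix_coact M ∘ i ∘ p = fmap B i ∘ fmap B p ∘ mix_coact M).
  { rewrite <- comp_assoc, Eip, <- fmap_comp, Eip. exact Cf. }
  assert (Eu : p ∘ mix_act M ∘ wbb_e B (mix_obj M) ∘ i = idm y).
  { lhs. rw (mix_unit M). rw Epi. close. }
  set (N := mixed_split (mix_assoc M) (mix_coassoc M) (mix_counit M)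
    (mix_compat M) Hip Cip Epi Eu).
  constructor.
  assert (Hi : IsModuleHom (T := B) (mix_act N) (mix_act M) i).
  { red. simpl. lhs. rw Hip. rw (f_equal (fmap B) Epi). close. }
  assert (Ci : IsComoduleHom (T := B) (mix_coact N) (mix_coact M) i).
  { red. simpl. rhs. rwb Cip. rw Epi. close. }
  assert (Hp : IsModuleHom (T := B) (mix_act M) (mix_act N) p).
  { red. simpl. rhs. rwb Hip. rw Epi. close. }
  assert (Cp : IsComoduleHom (T := B) (mix_coact M) (mix_coact N) p).
  { red. simpl. lhs. rw Cip. rw (f_equal (fmap B) Epi). close. }
  apply (@Build_Splitting (MixedBimod B) M _ N
    (Build_MixedHom (x := N) (y := M) Hi Ci)
    (Build_MixedHom (x := M) (y := N) Hp Cp)); apply MixedHom_ext; assumption.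
Qed.

(** * Maps between free mixed bimodules, and the diagonal action *)

Section MixedMaps.
Context (A : Category) (B : WeakBraidedBimonad A).
Implicit Types a b : A.
Local Notation H := (wbb_fun B).
Local Notation m := (wbb_m B).
Local Notation e := (wbb_e B).
Local Notation δ := (wbb_δ B).
Local Notation ε := (wbb_ε B).
Local Notation "⟨ f ⟩" := (fmap (wbb_fun B) f) (at level 0, format "⟨ f ⟩").
Local Notation mon := (wbb_isMonad (wbb_law B)).
Local Notation com := (wbb_isComonad (wbb_law B)).

(* A morphism of mixed bimodules between objects in the image of [K_omega] is
   right multiplication by a coinvariant. *)
Lemma mixed_free_mul a b (f : Hom (H b) (H a)) :
  IsModuleHom (T := H) (m b) (m a) f -> m a ∘ ⟨f⟩ ∘ ⟨e b⟩ = f.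
Proof. intros Hf. red in Hf. lhs. rwb Hf. rw (monad_unitr mon b). close. Qed.

Lemma mixed_free_coinvariant a b (f : Hom (H b) (H a)) :
  IsModuleHom (T := H) (m b) (m a) f ->
  IsComoduleHom (T := H) (δ b) (δ a) f ->
  xibar B a ∘ f ∘ e b = f ∘ e b.
Proof.
  intros Hf Cf. pose proof (mixed_free_mul Hf) as E. red in Cf.
  rewrite <- comp_assoc. apply xibar_coinvariant. lhs. rw Cf. rwb E.
  rwb (naturality δ (e b)). rwb (naturality δ f). rwb (naturality e (e b)).
  rwb (naturality e f). close.
Qed.

(* [⟨h⟩ ω] is the diagonal action on [H x] of a module [x]. *)
Lemma diagonal_assoc (x : A) (h : Hom (H x) x) :
  h ∘ ⟨h⟩ = h ∘ m x ->
  (⟨h⟩ ∘ omega B x) ∘ ⟨⟨h⟩ ∘ omega B x⟩ = (⟨h⟩ ∘ omega B x) ∘ m (H x).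
Proof.
  intros Eh. lhs. rw (naturality (omega B) h). rw (f_equal (fmap H) Eh).
  rwb (omega_mH B x). close.
Qed.

Context (a : A).
Local Notation μ := (⟨m a⟩ ∘ omega B (H a)).

(** The diagonal action need not be unital: its unit acts as the idempotent [kappa]. Splitting
    [kappa] cuts out the part on which the action is unital. *)
Lemma kappa_diagonal : kappa B a = μ ∘ e (H (H a)).
Proof. now rewrite kappaE. Qed.

Lemma diagonal_kappa : μ ∘ ⟨kappa B a⟩ = μ.
Proof.
  rewrite kappa_diagonal. lhs.
  rw (diagonal_assoc (eq_sym (monad_assoc mon a))).
  rw (monad_unitr mon (H (H a))). close.
Qed.

Lemma kappa_diagonal_l : kappa B a ∘ μ = μ.
Proof.
  rewrite kappa_diagonal. lhs. rw (naturality e μ).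
  rw (diagonal_assoc (eq_sym (monad_assoc mon a))).
  rw (monad_unitl mon (H (H a))). close.
Qed.

Lemma δ_diagonal : δ (H a) ∘ μ = ⟨μ⟩ ∘ omega B (H (H a)) ∘ ⟨δ (H a)⟩.
Proof.
  lhs. rw (naturality δ (m a)). rw (omega_δH B (H a)). close.
Qed.

Lemma counit_kappa : ε (H a) ∘ kappa B a = m a ∘ xi B (H a).
Proof.
  rewrite kappa_alt. lhs. rw (naturality ε (m a)).
  rw (naturality ε (xi B (H a))). rw (comonad_counitl com (H a)). close.
Qed.

Lemma counit_diagonal : ε (H a) ∘ μ = m a ∘ ⟨ε (H a) ∘ kappa B a⟩.
Proof.
  rewrite counit_kappa. lhs. rw (naturality ε (m a)). rw (counit_omega B (H a)).
  rw (monad_assoc mon a). close.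
Qed.

End MixedMaps.

(** * Galois inverses from retractions of free bimodules *)

Section RetractGalois.
Context (A : Category) (B : WeakBraidedBimonad A).
Implicit Types a b : A.
Local Notation H := (wbb_fun B).
Local Notation m := (wbb_m B).
Local Notation e := (wbb_e B).
Local Notation δ := (wbb_δ B).
Local Notation ε := (wbb_ε B).
Local Notation "⟨ f ⟩" := (fmap (wbb_fun B) f) (at level 0, format "⟨ f ⟩").
Local Notation mon := (wbb_isMonad (wbb_law B)).
Local Notation com := (wbb_isComonad (wbb_law B)).

Context (a y : A) (i : Hom y (H (H a))) (p : Hom (H (H a)) y).
Hypotheses (i_p : i ∘ p = kappa B a) (p_i : p ∘ i = idm y).
Local Notation μ := (⟨m a⟩ ∘ omega B (H a)).

Lemma kappa_split_action : i ∘ p ∘ μ = μ ∘ ⟨i⟩ ∘ ⟨p⟩.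
Proof.
  lhs. rw i_p. rw (kappa_diagonal_l B a). unfold R; clear R. rhs.
  rw (f_equal (fmap H) i_p). rw (diagonal_kappa B a). close.
Qed.

Lemma kappa_split_coaction : δ (H a) ∘ i ∘ p = ⟨i⟩ ∘ ⟨p⟩ ∘ δ (H a).
Proof.
  lhs. rw i_p. unfold R; clear R. rhs. rw (f_equal (fmap H) i_p).
  rwb (δ_kappa B a). close.
Qed.

Lemma kappa_split_unit : p ∘ μ ∘ e (H (H a)) ∘ i = idm y.
Proof.
  lhs. rwb (kappa_diagonal B a). rwb i_p. rw p_i. rw p_i. close.
Qed.

(* The cofree mixed bimodule on the free module [H a]. *)
Definition kappa_mixed : MixedBimodule B :=
  mixed_split (diagonal_assoc (eq_sym (monad_assoc mon a)))
    (eq_sym (comonad_coassoc com (H a))) (comonad_counitl com (H a))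
    (δ_diagonal B a) kappa_split_action kappa_split_coaction p_i
    kappa_split_unit.

(** By cofreeness, [i c] is determined by [k = ε i c]. This [k] is a morphism of free modules, hence
    right multiplication by [g = k e], which makes [i c] the Galois map after [H g]. *)
Lemma kappa_mixed_factor (N : A) (c : MixedHom (K_obj B N) kappa_mixed) :
  exists g : Hom N (H a), i ∘ mix_hom c = sigma B a ∘ ⟨g⟩.
Proof.
  destruct c as [f Hf Cf]. red in Hf, Cf. simpl in *.
  assert (Eκ : kappa B a ∘ i ∘ f = i ∘ f).
  { lhs. rwb i_p. rw p_i. close. }
  set (k := ε (H a) ∘ i ∘ f).
  assert (Hk : k ∘ m N = m a ∘ ⟨k⟩).
  { unfold k. lhs. rw Hf. rw i_p. rw (kappa_diagonal_l B a).
    rw (counit_diagonal B a). rw (f_equal (fmap H) Eκ). close. }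
  assert (Ek : k = m a ∘ ⟨k ∘ e N⟩).
  { rhs. rwb Hk. rw (monad_unitr mon N). close. }
  assert (Ef : i ∘ f = ⟨k⟩ ∘ δ N).
  { unfold k. rhs. rwb Cf. rw (f_equal (fmap H) i_p). rwb (δ_kappa B a).
    rw Eκ. rw (comonad_counitr com (H a)). close. }
  exists (k ∘ e N). lhs. rw Ef. rewrite Ek. flat.
  rwb (naturality δ (k ∘ e N)). unfold R; rewrite sigmaE. flat. reflexivity.
Qed.

(* A section [t] of a morphism [K N -> G a] gives the right inverse
   [⟨g⟩ t p] of [sigma]; corrected by [balance] it becomes two-sided,
   because an endomorphism [k] of [K (H a)] with [sigma k = sigma] satisfies
   [balance k = balance]. *)
Lemma galois_of_retract (N : A) (c : MixedHom (K_obj B N) kappa_mixed)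
  (t : MixedHom kappa_mixed (K_obj B N)) :
  mix_hom c ∘ mix_hom t = idm y ->
  exists β, IsGaloisInverse (B := B) (a := a) β.
Proof.
  intros Ect. destruct (kappa_mixed_factor c) as [g Eg].
  destruct c as [f Hf' Cf'], t as [t Ht Ct]. red in Ht, Ct. simpl in *.
  clear Hf' Cf'.
  set (s := ⟨g⟩ ∘ t ∘ p).
  assert (Eσs : sigma B a ∘ s = kappa B a).
  { unfold s. lhs. rwb Eg. rw Ect. rw i_p. close. }
  set (k := s ∘ sigma B a).
  assert (Hk : IsModuleHom (T := H) (m (H a)) (m (H a)) k).
  { red. unfold k, s. lhs. rw (sigma_mH B a). rwb (diagonal_kappa B a).
    rwb (f_equal (fmap H) i_p). rw Ht. rwb (naturality m g). close. }
  assert (Ck : IsComoduleHom (T := H) (δ (H a)) (δ (H a)) k).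
  { red. unfold k, s. lhs. rw (naturality δ g). rw Ct. rw i_p.
    rw (kappa_sigma B a). rw (δ_sigma B a). close. }
  pose proof (mixed_free_mul Hk) as Ek.
  pose proof (mixed_free_coinvariant Hk Ck) as Ck'.
  assert (Em : m a ∘ k ∘ e (H a) = idm (H a)).
  { lhs. rwb (counit_sigma B a). unfold k. rw Eσs.
    rw (kappa_sigma B a). rw (counit_sigma B a). rw (monad_unitl mon a). close. }
  exists (balance B a ∘ s). split.
  - lhs. rw (sigma_balance B a). rw Eσs. close.
  - transitivity (balance B a ∘ k); [unfold k; flat; reflexivity |].
    lhs. rwb Ek. rwb (f_equal (fmap H) Ck').
    rw (balance_coequalizes B a). rw (f_equal (fmap H) Ck').
    rw (f_equal (fmap H) Em). close.
  - lhs. rw (balance_idem B a). close.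
Qed.
End RetractGalois.

Definition RetractsOfFree (A : Category) (B : WeakBraidedBimonad A) : Prop :=
  forall M : MixedBimod B, exists (N : A) (c : Hom (K_omega B N) M)
    (t : Hom M (K_omega B N)), c ∘ t = idm M.

Lemma galois_of_retracts (A : Category) (B : WeakBraidedBimonad A)
  (G : @Splitting (FunCat A A) (B ⊙ B) (kappa B)) :
  RetractsOfFree B -> IsGalois B.
Proof.
  intros HR a.
  set (i := (split_incl G : NatTrans _ _) a).
  set (p := (split_proj G : NatTrans _ _) a).
  assert (Eip : i ∘ p = kappa B a)
    by exact (f_equal (fun t => component t a) (split_incl_proj G)).
  assert (Epi : p ∘ i = idm _)
    by exact (f_equal (fun t => component t a) (split_proj_incl G)).
  destruct (HR (kappa_mixed Eip Epi)) as (N & c & t & E).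
  apply (galois_of_retract (c := c) (t := t)).
  exact (f_equal (@mix_hom _ _ _ _) E).
Qed.

(** * Separability of the base, transported along the free functor *)

Section Separability.
Context (A : Category) (B : WeakBraidedBimonad A).
Implicit Types a b : A.
Local Notation H := (wbb_fun B).
Local Notation m := (wbb_m B).
Local Notation e := (wbb_e B).
Local Notation δ := (wbb_δ B).
Local Notation "⟨ f ⟩" := (fmap (wbb_fun B) f) (at level 0, format "⟨ f ⟩").
Local Notation mon := (wbb_isMonad (wbb_law B)).
Local Notation com := (wbb_isComonad (wbb_law B)).

Context (X : @Splitting (FunCat A A) H (xibar B)).
Local Notation ι := (xi_incl X).
Local Notation q := (xi_proj X).
Local Notation Hs := (Hxi X).
Local Notation K := (K_omega B).

Lemma rho_module a :
  IsModuleHom (T := H) (m (Hs a)) (m a) (m a ∘ ⟨ι a⟩).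
Proof.
  red. lhs. rwb (naturality m (ι a)). rw (monad_assoc mon a). close.
Qed.

Lemma rho_comodule a :
  IsComoduleHom (T := H) (δ (Hs a)) (δ a) (m a ∘ ⟨ι a⟩).
Proof.
  red. lhs. rwb (f_equal (fmap H) (xibar_incl X a)). rw (δ_m_xibar B a).
  rw (f_equal (fmap H) (xibar_incl X a)). rw (naturality δ (ι a)). close.
Qed.

Lemma theta_comodule a :
  IsComoduleHom (T := H) (δ a) (δ (Hs a)) (⟨q a⟩ ∘ δ a).
Proof.
  red. lhs. rw (naturality δ (q a)). rw (comonad_coassoc com a). close.
Qed.

Lemma xibar_m_δ a :
  ⟨xibar B a⟩ ∘ δ a ∘ m a = ⟨xibar B a⟩ ∘ m (H a) ∘ ⟨δ a⟩.
Proof. dual_exact (δ_m_xibar (opB B) a). Qed.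

Lemma theta_module a :
  IsModuleHom (T := H) (m a) (m (Hs a)) (⟨q a⟩ ∘ δ a).
Proof.
  red. lhs. rwb (f_equal (fmap H) (xi_proj_xibar X a)). rw (xibar_m_δ a).
  rw (f_equal (fmap H) (xi_proj_xibar X a)). rwb (naturality m (q a)). close.
Qed.

Definition rho_map a : @Hom (MixedBimod B) (K (Hs a)) (K a) :=
  @Build_MixedHom A B (K_obj B (Hs a)) (K_obj B a) _
    (rho_module a) (rho_comodule a).

Definition theta_map a : @Hom (MixedBimod B) (K a) (K (Hs a)) :=
  @Build_MixedHom A B (K_obj B a) (K_obj B (Hs a)) _
    (theta_module a) (theta_comodule a).

Lemma rho_theta a : rho_map a ∘ theta_map a = idm (K a).
Proof.
  apply MixedHom_ext. simpl. lhs.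
  rw (f_equal (fmap H) (xi_incl_proj X a)). rw (convolution_id_xibar B a).
  close.
Qed.

Section MixedFree.
Context (a b : A) (f : @Hom (MixedBimod B) (K b) (K a)).

(** [f] is right multiplication by a coinvariant, and coinvariants are closed under products; so [f]
    restricts to the base, with restriction [q f ι]. *)
Lemma mixed_free_conj : mix_hom f ∘ ι b = xibar B a ∘ mix_hom f ∘ ι b.
Proof.
  destruct f as [g Hg Cg]. simpl in *.
  pose proof (mixed_free_mul Hg) as E.
  pose proof (mixed_free_coinvariant Hg Cg) as C.
  assert (E' : g ∘ ι b = m a ∘ xibar B (H a) ∘ ⟨xibar B a⟩ ∘ ⟨g⟩ ∘ ⟨e b⟩ ∘ ι b).
  { rhs. rw (f_equal (fmap H) C). rw (naturality (xibar B) g).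
    rw (naturality (xibar B) (e b)). rw (xibar_incl X b). rw E. close. }
  lhs. rw E'. rwb (xibar_mul_closed B a). rwb E'. close.
Qed.

Lemma mixed_free_conj' :
  q a ∘ mix_hom f ∘ xibar B b = q a ∘ mix_hom f.
Proof.
  destruct f as [g Hg Cg]. simpl in *.
  pose proof (mixed_free_mul Hg) as E. rewrite <- E. lhs.
  rwb (naturality (xibar B) (e b)). rwb (naturality (xibar B) g).
  rwb (xi_proj_xibar X a). rw (xibar_m_xibar B a).
  rw (xi_proj_xibar X a). close.
Qed.

Lemma rho_natural :
  f ∘ rho_map b = rho_map a ∘ fmap K (q a ∘ mix_hom f ∘ ι b).
Proof.
  apply MixedHom_ext. simpl. rhs. rw (f_equal (fmap H) (xi_incl_proj X a)).
  rwb (f_equal (fmap H) mixed_free_conj).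
  pose proof (mix_hom_module f) as Hf. red in Hf. simpl in Hf. rwb Hf. close.
Qed.

Lemma theta_natural :
  fmap K (q a ∘ mix_hom f ∘ ι b) ∘ theta_map b = theta_map a ∘ f.
Proof.
  apply MixedHom_ext. simpl. lhs. rw (f_equal (fmap H) (xi_incl_proj X b)).
  rw (f_equal (fmap H) mixed_free_conj').
  pose proof (mix_hom_comodule f) as Cf. red in Cf. simpl in Cf. rwb Cf. close.
Qed.
End MixedFree.

Definition K_separability : SeparabilityData K.
Proof.
  refine (@Build_SeparabilityData A (MixedBimod B) K Hs rho_map theta_map
    rho_theta _).
  intros a b f. exists (q a ∘ mix_hom f ∘ ι b).
  split; [apply rho_natural | apply theta_natural].
Defined.

Lemma retracts_of_monadic (R : Functor (MixedBimod B) A)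
  (adj : Adjunction K R) : Monadic adj -> RetractsOfFree B.
Proof.
  intros HM M.
  destruct (separable_counit_section K_separability HM M) as [t Et].
  now exists (R M), (adj_counit adj M), t.
Qed.

Lemma retracts_of_comonadic (L : Functor (MixedBimod B) A)
  (adj : Adjunction L K) : Comonadic adj -> RetractsOfFree B.
Proof.
  intros HM M.
  destruct (separable_unit_retraction K_separability HM M) as [t Et].
  now exists (L M), t, (adj_unit adj M).
Qed.
End Separability.

(** * Coinvariants *)

Section CoinvariantProjection.
Context (A : Category) (B : WeakBraidedBimonad A).
Implicit Types a b : A.
Local Notation H := (wbb_fun B).
Local Notation m := (wbb_m B).
Local Notation e := (wbb_e B).
Local Notation δ := (wbb_δ B).
Local Notation ε := (wbb_ε B).
Local Notation "⟨ f ⟩" := (fmap (wbb_fun B) f) (at level 0, format "⟨ f ⟩").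
Local Notation mon := (wbb_isMonad (wbb_law B)).
Local Notation com := (wbb_isComonad (wbb_law B)).

Context (S : NatTrans H H)
  (S_antipode : IsWeakAntipode (B := B) S).
Context (x : A) (h : Hom (H x) x) (θ : Hom x (H x)).
Hypotheses (h_assoc : h ∘ ⟨h⟩ = h ∘ m x) (h_unit : h ∘ e x = idm x)
  (θ_coassoc : ⟨θ⟩ ∘ θ = δ x ∘ θ) (θ_counit : ε x ∘ θ = idm x)
  (h_θ : θ ∘ h = ⟨h⟩ ∘ omega B x ∘ ⟨θ⟩).
Local Notation E := (h ∘ S x ∘ θ).
Local Notation ζ := (⟨h⟩ ∘ δ x ∘ e x).

(** Compatibility applied to [1 m] gives [θ m = m_{-2} ⊗ xi(m_{-1}) m_0]; the counit on the first
    leg finishes. *)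
Lemma action_xi_coaction : h ∘ xi B x ∘ θ = idm x.
Proof.
  assert (Eθ : θ = ⟨h⟩ ∘ ⟨xi B x⟩ ∘ δ x ∘ θ).
  { transitivity (θ ∘ h ∘ e x); [now rw h_unit |]. lhs. rw h_θ.
    rwb (naturality e θ). rw (omega_eH B x). close. }
  rhs. rwb θ_counit. rw Eθ. rw (naturality ε h). rw (naturality ε (xi B x)).
  rw (comonad_counitl com x). close.
Qed.

Lemma projection_reconstructs : h ∘ ⟨E⟩ ∘ θ = idm x.
Proof.
  destruct (proj1 (antipode_components S) S_antipode) as (S1 & _ & _).
  lhs. rw h_assoc. rw θ_coassoc. rw (S1 x). rw action_xi_coaction. close.
Qed.

Lemma diagonal_zeta : ⟨h⟩ ∘ omega B x ∘ ⟨ζ⟩ = ⟨h⟩ ∘ δ x.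
Proof.
  lhs. rw (naturality (omega B) h). rw (f_equal (fmap H) h_assoc).
  rwb (K_compat B x). rw (monad_unitr mon x). close.
Qed.

(* On the image of [E], [θ] is [y ↦ 1_1 ⊗ 1_2 y].  Both
   [θ E] and [ζ E] are recovered from [θ] through the diagonal action, and the
   antipode cancels that action. *)
Lemma projection_coinvariant : θ ∘ E = ζ ∘ E.
Proof.
  destruct (proj1 (antipode_components S) S_antipode) as (S1 & S2 & S3).
  assert (Eζ : ⟨h⟩ ∘ omega B x ∘ ⟨ζ⟩ ∘ ⟨E⟩ ∘ θ = θ).
  { rewrite diagonal_zeta. lhs. rw (naturality δ E). rwb θ_coassoc.
    rw (f_equal (fmap H) projection_reconstructs). close. }
  assert (EE : h ∘ ⟨E⟩ ∘ xibar B x ∘ θ = E).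
  { lhs. rw h_assoc. rwb (naturality (xibar B) θ). rw θ_coassoc.
    rw (S3 x). close. }
  transitivity (⟨h⟩ ∘ omega B x ∘ ⟨θ⟩ ∘ S x ∘ θ); [now rwb h_θ |].
  transitivity (⟨h⟩ ∘ omega B x ∘ ⟨⟨h⟩ ∘ omega B x ∘ ⟨ζ⟩ ∘ ⟨E⟩ ∘ θ⟩ ∘ S x ∘ θ);
    [now rewrite Eζ |].
  transitivity ((⟨h⟩ ∘ omega B x) ∘ m (H x) ∘ ⟨⟨ζ⟩ ∘ ⟨E⟩ ∘ θ⟩ ∘ S x ∘ θ).
  { rewrite <- (diagonal_assoc h_assoc). flat. reflexivity. }
  transitivity (⟨h⟩ ∘ omega B x ∘ ⟨ζ⟩ ∘ ⟨E⟩ ∘ xibar B x ∘ θ).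
  { lhs. rwb (naturality S θ). rwb (naturality S (⟨E⟩)).
    rwb (naturality S (⟨ζ⟩)). rw θ_coassoc. rwb (naturality δ E).
    rwb (naturality δ ζ). rw (S2 (H x)). rw (naturality (xibar B) ζ).
    rw (naturality (xibar B) E). close. }
  rewrite diagonal_zeta. lhs. rwb (naturality (xibar B) E). rw (δ_xibar B x).
  rwb (f_equal (fmap H) h_assoc). rwb (naturality δ h). rwb (naturality e h).
  rw (naturality (xibar B) E). rw EE. close.
Qed.

(** On a coinvariant [m] the projection is [S(1_1) 1_2 m = xibar(1) m = m]. *)
Lemma projection_idem : E ∘ E = E.
Proof.
  destruct (proj1 (antipode_components S) S_antipode) as (_ & S2 & _).
  transitivity (h ∘ S x ∘ (θ ∘ E)); [flat; reflexivity |].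
  rewrite projection_coinvariant. lhs. rw (naturality S h). rw h_assoc.
  rw (S2 x). rw (xibar_e B x). rw h_unit. close.
Qed.
End CoinvariantProjection.

Section CoinvariantProjectionDual.
Context (A : Category) (B : WeakBraidedBimonad A).
Implicit Types a b : A.
Local Notation H := (wbb_fun B).
Local Notation m := (wbb_m B).
Local Notation e := (wbb_e B).
Local Notation δ := (wbb_δ B).
Local Notation ε := (wbb_ε B).
Local Notation "⟨ f ⟩" := (fmap (wbb_fun B) f) (at level 0, format "⟨ f ⟩").

Context (S : NatTrans H H) (S_antipode : IsWeakAntipode (B := B) S).
Context (x : A) (h : Hom (H x) x) (θ : Hom x (H x)).
Hypotheses (h_assoc : h ∘ ⟨h⟩ = h ∘ m x) (h_unit : h ∘ e x = idm x)
  (θ_coassoc : ⟨θ⟩ ∘ θ = δ x ∘ θ) (θ_counit : ε x ∘ θ = idm x)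
  (h_θ : θ ∘ h = ⟨h⟩ ∘ omega B x ∘ ⟨θ⟩).
Local Notation E := (h ∘ S x ∘ θ).

Lemma compat_op : @comp (op A) _ _ _ h θ
  = @comp (op A) _ _ _ (@comp (op A) _ _ _ ⟨θ⟩ (omega (opB B) x)) ⟨h⟩.
Proof. rewrite omega_op. simpl. rewrite comp_assoc. exact h_θ. Qed.

(** The formula for [E] is self-dual, so this is [projection_coinvariant] for the opposite bimonad:
    the coinvariants are at the same time a quotient of invariants. *)
Lemma projection_invariant : E ∘ h = E ∘ (ε x ∘ m x ∘ ⟨θ⟩).
Proof.
  pose proof (@projection_coinvariant (op A) (opB B) (opN S)
    (antipode_op S_antipode) x θ h θ_coassoc θ_counit h_assoc h_unit compat_op)
    as P.
  simpl in P. flat_in P. flat. exact P.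
Qed.

Lemma zeta_diagonal :
  ⟨ε x ∘ m x ∘ ⟨θ⟩⟩ ∘ omega B x ∘ ⟨θ⟩ = m x ∘ ⟨θ⟩.
Proof.
  pose proof (@diagonal_zeta (op A) (opB B) x θ θ_coassoc) as P.
  rewrite omega_op in P. simpl in P. flat_in P. flat. exact P.
Qed.
End CoinvariantProjectionDual.

Section Coinvariants.
Context (A : Category) (B : WeakBraidedBimonad A).
Implicit Types a b : A.
Local Notation H := (wbb_fun B).
Local Notation m := (wbb_m B).
Local Notation e := (wbb_e B).
Local Notation δ := (wbb_δ B).
Local Notation ε := (wbb_ε B).
Local Notation "⟨ f ⟩" := (fmap (wbb_fun B) f) (at level 0, format "⟨ f ⟩").
Local Notation mon := (wbb_isMonad (wbb_law B)).
Local Notation com := (wbb_isComonad (wbb_law B)).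

Context (S : NatTrans H H) (S_antipode : IsWeakAntipode (B := B) S).
Local Notation K := (K_omega B).

Definition coinvariant_projection (M : MixedBimodule B) :
  Hom (mix_obj M) (mix_obj M) :=
  mix_act M ∘ S (mix_obj M) ∘ mix_coact M.

Lemma coinvariant_projection_idem M :
  coinvariant_projection M ∘ coinvariant_projection M = coinvariant_projection M.
Proof.
  exact (projection_idem S_antipode (mix_assoc M) (mix_unit M) (mix_coassoc M)
    (mix_counit M) (mix_compat M)).
Qed.

Lemma coinvariant_projection_natural M N (f : MixedHom M N) :
  coinvariant_projection N ∘ mix_hom f = mix_hom f ∘ coinvariant_projection M.
Proof.
  destruct f as [f Hf Cf]. red in Hf, Cf. simpl. unfold coinvariant_projection.
  lhs. rw Cf. rw (naturality S f). rwb Hf. close.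
Qed.

Lemma coinvariant_projection_free a :
  coinvariant_projection (K_obj B a) = xibar B a.
Proof.
  destruct (proj1 (antipode_components S) S_antipode) as (_ & S2 & _).
  apply S2.
Qed.

Context (sp : forall M, Splitting (coinvariant_projection M)).
Local Notation Q M := (split_obj (sp M)).
Local Notation i M := (split_incl (sp M)).
Local Notation q M := (split_proj (sp M)).

Lemma incl_proj M : i M ∘ q M = mix_act M ∘ S (mix_obj M) ∘ mix_coact M.
Proof. exact (split_incl_proj (sp M)). Qed.

Lemma incl_proj_free a : i (K_obj B a) ∘ q (K_obj B a) = xibar B a.
Proof.
  rewrite <- coinvariant_projection_free. exact (split_incl_proj (sp _)).
Qed.

Lemma proj_incl M : q M ∘ i M = idm _.
Proof. exact (split_proj_incl (sp M)). Qed.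

Lemma incl_proj_natural M N (f : MixedHom M N) :
  i N ∘ q N ∘ mix_hom f = mix_hom f ∘ i M ∘ q M.
Proof.
  rewrite <- comp_assoc, !comp_assoc, <- (comp_assoc (mix_hom f)).
  rewrite !split_incl_proj. apply coinvariant_projection_natural.
Qed.

Lemma coinvariants_hom_comp M N P (g : MixedHom N P) (f : MixedHom M N) :
  (q P ∘ mix_hom g ∘ i N) ∘ (q N ∘ mix_hom f ∘ i M)
    = q P ∘ (mix_hom g ∘ mix_hom f) ∘ i M.
Proof.
  lhs. rw (incl_proj_natural f). rw (proj_incl M). close.
Qed.

Definition coinvariants : Functor (MixedBimod B) A := {|
  fobj := fun M : MixedBimod B => Q M;
  fmap := fun (M N : MixedBimod B) (f : Hom M N) => q N ∘ mix_hom f ∘ i M;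
  fmap_id := fun M : MixedBimod B =>
    eq_trans (f_equal (fun t => t ∘ i M) (comp_idr (q M))) (proj_incl M);
  fmap_comp := fun (M N P : MixedBimod B) g f =>
    eq_sym (coinvariants_hom_comp g f)
|}.

Section Object.
Context (M : MixedBimodule B).
Local Notation x := (mix_obj M).
Local Notation h := (mix_act M).
Local Notation θ := (mix_coact M).

Lemma coaction_incl : θ ∘ i M = ⟨h⟩ ∘ δ x ∘ e x ∘ i M.
Proof.
  transitivity (θ ∘ (i M ∘ q M) ∘ i M); [rhs; rw (proj_incl M); close |].
  rewrite incl_proj.
  rewrite (projection_coinvariant S_antipode (mix_assoc M) (mix_unit M)
    (mix_coassoc M) (mix_counit M) (mix_compat M)).
  lhs. rwb (incl_proj M). rw (proj_incl M). close.
Qed.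

Lemma proj_action : q M ∘ h = q M ∘ ε x ∘ m x ∘ ⟨θ⟩.
Proof.
  pose proof (projection_invariant S_antipode (mix_assoc M) (mix_unit M)
    (mix_coassoc M) (mix_counit M) (mix_compat M)) as E.
  rewrite <- incl_proj in E.
  apply (f_equal (fun t => q M ∘ t)) in E. flat_in E.
  assert (P : forall z (t : Hom z _), q M ∘ (i M ∘ t) = t)
    by (intros z t; rewrite comp_assoc, proj_incl; apply comp_idl).
  rewrite !P in E. flat. exact E.
Qed.

Lemma counit_module : IsModuleHom (T := H) (m (Q M)) h (h ∘ ⟨i M⟩).
Proof.
  red. lhs. rwb (naturality m (i M)). rwb (mix_assoc M). close.
Qed.

Lemma counit_comodule : IsComoduleHom (T := H) (δ (Q M)) θ (h ∘ ⟨i M⟩).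
Proof.
  red. lhs. rw (mix_compat M). rw (f_equal (fmap H) coaction_incl).
  rw (diagonal_zeta (mix_assoc M)). rw (naturality δ (i M)). close.
Qed.

Lemma unit_comodule : IsComoduleHom (T := H) θ (δ (Q M)) (⟨q M⟩ ∘ θ).
Proof.
  red. lhs. rw (naturality δ (q M)). rwb (mix_coassoc M). close.
Qed.

Lemma unit_module : IsModuleHom (T := H) h (m (Q M)) (⟨q M⟩ ∘ θ).
Proof.
  red. lhs. rw (mix_compat M). rw (f_equal (fmap H) proj_action).
  rw (zeta_diagonal (mix_coassoc M)). rwb (naturality m (q M)). close.
Qed.

Definition coinvariants_counit : @Hom (MixedBimod B) (K (Q M)) M :=
  @Build_MixedHom A B (K_obj B (Q M)) M _ counit_module counit_comodule.

Definition coinvariants_unit : @Hom (MixedBimod B) M (K (Q M)) :=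
  @Build_MixedHom A B M (K_obj B (Q M)) _ unit_module unit_comodule.

Lemma coinvariants_counit_unit :
  coinvariants_counit ∘ coinvariants_unit = idm (M : MixedBimod B).
Proof.
  apply MixedHom_ext. simpl. lhs. rw (f_equal (fmap H) (incl_proj M)).
  rw (projection_reconstructs S_antipode (mix_assoc M) (mix_unit M)
    (mix_coassoc M) (mix_counit M) (mix_compat M)). close.
Qed.
End Object.

Lemma counit_natural (M N : MixedBimod B) (f : Hom M N) :
  coinvariants_counit N ∘ fmap K (fmap coinvariants f)
    = f ∘ coinvariants_counit M.
Proof.
  apply MixedHom_ext. simpl.
  pose proof (mix_hom_module f) as Hf. red in Hf. rhs. rw Hf.
  unfold R; clear R. rhs. rw (f_equal (fmap H) (incl_proj_natural f)).
  rw (f_equal (fmap H) (proj_incl M)). close.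
Qed.

Lemma unit_natural (M N : MixedBimod B) (f : Hom M N) :
  coinvariants_unit N ∘ f
    = fmap K (fmap coinvariants f) ∘ coinvariants_unit M.
Proof.
  apply MixedHom_ext. simpl.
  pose proof (mix_hom_comodule f) as Cf. red in Cf. lhs. rw Cf.
  unfold R; clear R. rhs. rwb (f_equal (fmap H) (incl_proj_natural f)).
  rw (f_equal (fmap H) (proj_incl N)). close.
Qed.

Lemma free_unit_natural a b (f : Hom a b) :
  (q (K_obj B b) ∘ e b) ∘ f
    = fmap coinvariants (fmap K f) ∘ (q (K_obj B a) ∘ e a).
Proof.
  simpl. lhs. rw (naturality e f). unfold R; clear R. rhs.
  rw (incl_proj_free a). rw (xibar_e B a). close.
Qed.

Lemma free_counit_natural a b (f : Hom a b) :
  (ε b ∘ i (K_obj B b)) ∘ fmap coinvariants (fmap K f)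
    = f ∘ (ε a ∘ i (K_obj B a)).
Proof.
  simpl. lhs. rw (incl_proj_free b). rw (counit_xibar B b).
  rw (naturality ε f). close.
Qed.

Definition right_adjunction : Adjunction K coinvariants.
Proof.
  refine (@Build_Adjunction A (MixedBimod B) K coinvariants
    (Build_NatTrans (F := idF A) (G := coinvariants ⊙ K)
      (component := fun a => q (K_obj B a) ∘ e a) free_unit_natural)
    (Build_NatTrans (F := K ⊙ coinvariants) (G := idF (MixedBimod B))
      (component := coinvariants_counit) counit_natural) _ _).
  - intros a. apply MixedHom_ext. simpl. lhs.
    rw (f_equal (fmap H) (incl_proj_free a)). rw (f_equal (fmap H) (xibar_e B a)).
    rw (monad_unitr mon a). close.
  - intros M. simpl. lhs. rw (incl_proj_free (Q M)). rw (xibar_e B (Q M)).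
    rwb (naturality e (i M)). rw (mix_unit M). rw (proj_incl M). close.
Defined.

Definition left_adjunction : Adjunction coinvariants K.
Proof.
  refine (@Build_Adjunction (MixedBimod B) A coinvariants K
    (Build_NatTrans (F := idF (MixedBimod B)) (G := K ⊙ coinvariants)
      (component := coinvariants_unit) unit_natural)
    (Build_NatTrans (F := coinvariants ⊙ K) (G := idF A)
      (component := fun a => ε a ∘ i (K_obj B a)) free_counit_natural) _ _).
  - intros M. simpl. lhs. rw (incl_proj_free (Q M)). rw (counit_xibar B (Q M)).
    rw (naturality ε (q M)). rw (mix_counit M). rw (proj_incl M). close.
  - intros a. apply MixedHom_ext. simpl. lhs.
    rw (f_equal (fmap H) (incl_proj_free a)).
    rw (f_equal (fmap H) (counit_xibar B a)).
    rw (comonad_counitr com a). close.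
Defined.

Lemma right_adjunction_monadic : CauchyComplete A ->
  FullyFaithful (monadic_comparison right_adjunction) /\
  EssentiallySurjective (monadic_comparison right_adjunction).
Proof.
  intros HA.
  apply (separable_monadic (adj := right_adjunction)
    (u := adj_unit left_adjunction) (mixed_cauchy HA)).
  exact coinvariants_counit_unit.
Qed.

Lemma left_adjunction_comonadic : CauchyComplete A ->
  FullyFaithful (comonadic_comparison left_adjunction) /\
  EssentiallySurjective (comonadic_comparison left_adjunction).
Proof.
  intros HA.
  apply (coseparable_comonadic (adj := left_adjunction)
    (u := adj_counit right_adjunction) (mixed_cauchy HA)).
  exact coinvariants_counit_unit.
Qed.
End Coinvariants.

Lemma fully_faithful_comp (C D E : Category) (G : Functor D E) (F : Functor C D) :
  FullyFaithful G -> FullyFaithful F -> FullyFaithful (G ⊙ F).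
Proof.
  intros HG HF a b g. destruct (HG _ _ g) as (f & Ef & _).
  destruct (HF _ _ f) as (t & Et & _). exists t. split.
  - simpl. now rewrite Et.
  - intros t' Et'. apply (fully_faithful_inj HF), (fully_faithful_inj HG).
    simpl in Et'. now rewrite Et', Et.
Qed.

Lemma essentially_surjective_comp (C D E : Category) (G : Functor D E)
  (F : Functor C D) : EssentiallySurjective G -> EssentiallySurjective F ->
  EssentiallySurjective (G ⊙ F).
Proof.
  intros HG HF x. destruct (HG x) as (d & g & g' & E1 & E2).
  destruct (HF d) as (c & f & f' & E3 & E4).
  exists c, (g ∘ fmap G f), (fmap G f' ∘ g'). simpl. split.
  - lhs. rw E1. rw (f_equal (fmap G) E3). close.
  - lhs. rw (f_equal (fmap G) E4). rw E2. close.
Qed.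

(** * Module categories of isomorphic monads *)

Section MonadIso.
Context (C : Category) (P T : Monad C) (j : NatTrans T P) (k : NatTrans P T).
Hypotheses (k_j : forall a, k a ∘ j a = idm (T a))
  (j_k : forall a, j a ∘ k a = idm (P a))
  (j_unit : forall a, j a ∘ monad_unit T a = monad_unit P a)
  (j_mul : forall a,
    j a ∘ monad_mul T a = monad_mul P a ∘ fmap P (j a) ∘ j (T a)).

Lemma restrict_isModule (N : Module P) :
  IsModule (T := T) (mod_act N ∘ j (mod_obj N)).
Proof.
  destruct N as [N n [Ha Hu]]. simpl. split.
  - lhs. rw (naturality j (n ∘ j N)). rw Ha. rwb (j_mul N). close.
  - lhs. rw (j_unit N). rw Hu. close.
Qed.

Lemma restrict_isModuleHom (N N' : Module P) (f : ModuleHom N N') :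
  IsModuleHom (T := T) (mod_act N ∘ j (mod_obj N))
    (mod_act N' ∘ j (mod_obj N')) (mod_hom f).
Proof.
  pose proof (mod_hom_law f) as E. red in E |- *. lhs. rw E.
  rwb (naturality j (mod_hom f)). close.
Qed.

Program Definition restrict : Functor (EM P) (EM T) := {|
  fobj := fun N : EM P => Build_Module (restrict_isModule N) : EM T;
  fmap := fun (N N' : EM P) (f : Hom N N') =>
    @Build_ModuleHom C T (Build_Module (restrict_isModule N))
      (Build_Module (restrict_isModule N')) (mod_hom f) (restrict_isModuleHom f)
|}.
Next Obligation. now apply ModuleHom_ext. Qed.
Next Obligation. now apply ModuleHom_ext. Qed.

Lemma restrict_fully_faithful : FullyFaithful restrict.
Proof.
  intros N N' [f Hf]. red in Hf. simpl in f, Hf.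
  assert (Hf' : IsModuleHom (T := P) (mod_act N) (mod_act N') f).
  { red. transitivity (f ∘ mod_act N ∘ (j (mod_obj N) ∘ k (mod_obj N)));
      [rewrite j_k; now flat |].
    lhs. rw Hf. rw (naturality j f). rw (j_k (mod_obj N)). close. }
  exists (Build_ModuleHom Hf'). split.
  - now apply ModuleHom_ext.
  - intros g Eg. apply ModuleHom_ext. simpl.
    exact (eq_sym (f_equal (@mod_hom _ _ _ _) Eg)).
Qed.

Lemma restrict_essentially_surjective : EssentiallySurjective restrict.
Proof.
  intros [N n [Ha Hu]].
  assert (Hk : IsModule (T := P) (n ∘ k N)).
  { split.
    (* [j_mul] mentions the multiplication of [P] only between copies of [j]; inserting [j] and [k]
       in inverse pairs brings it into that form. *)
    - transitivity (n ∘ (k N ∘ monad_mul P N) ∘ fmap P (j N) ∘ j (T N)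
        ∘ k (T N) ∘ fmap P (k N)).
      + rhs. rwb (j_mul N). rw (k_j N). rwb Ha. rwb (naturality k n). close.
      + lhs. rw (j_k (T N)). rw (f_equal (fmap P) (j_k N)). close.
    - lhs. rwb (j_unit N). rw (k_j N). rw Hu. close. }
  set (M := Build_Module Hk : Module P).
  assert (E : mod_act (restrict M) = n).
  { simpl. lhs. rw (k_j N). close. }
  exists M.
  assert (H1 : IsModuleHom (T := T) (mod_act (restrict M)) n (idm N)).
  { rewrite E. apply IsModuleHom_id. }
  assert (H2 : IsModuleHom (T := T) n (mod_act (restrict M)) (idm N)).
  { rewrite E. apply IsModuleHom_id. }
  exists (@Build_ModuleHom C T (restrict M)
    (Build_Module (Build_IsModule (T := T) Ha Hu)) (idm N) H1).
  exists (@Build_ModuleHom C T (Build_Module (Build_IsModule (T := T) Ha Hu))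
    (restrict M) (idm N) H2).
  split; apply ModuleHom_ext; apply comp_idl.
Qed.
End MonadIso.

(** * The monad [Hxi] and the equivalence of its modules with mixed bimodules *)

Section XiMonad.
Context (A : Category) (B : WeakBraidedBimonad A).
Implicit Types a b : A.
Local Notation H := (wbb_fun B).
Local Notation m := (wbb_m B).
Local Notation e := (wbb_e B).
Local Notation "⟨ f ⟩" := (fmap (wbb_fun B) f) (at level 0, format "⟨ f ⟩").
Local Notation mon := (wbb_isMonad (wbb_law B)).

Context (X : @Splitting (FunCat A A) H (xibar B)).
Local Notation ι := (xi_incl X).
Local Notation q := (xi_proj X).
Local Notation Hs := (Hxi X).

(** The base is closed under multiplication, so the projection inside [xi_mul] disappears after [ι];
    the monad laws of [Hxi] are thereby restricted from [H]. *)
Lemma incl_mul a : ι a ∘ xi_mul X a = m a ∘ ⟨ι a⟩ ∘ ι (Hs a).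
Proof.
  simpl. lhs. rw (xi_incl_proj X a).
  rwb (f_equal (fmap H) (xibar_incl X a)). rwb (xibar_incl X (Hs a)).
  rwb (naturality (xibar B) (ι a)).
  rwb (naturality (xibar B) (xibar B a)). rw (xibar_mul_closed B a).
  rw (naturality (xibar B) (xibar B a)). rw (naturality (xibar B) (ι a)).
  rw (xibar_incl X (Hs a)). rw (f_equal (fmap H) (xibar_incl X a)). close.
Qed.

Lemma xi_isMonad : IsMonad (xi_mul X) (xi_unit X).
Proof.
  split; intros a.
  - transitivity (q a ∘ m a ∘ ⟨ι a⟩ ∘ (ι (Hs a) ∘ xi_mul X (Hs a)));
      [simpl; flat; reflexivity |].
    rewrite (incl_mul (Hs a)).
    transitivity (q a ∘ m a ∘ ⟨ι a ∘ xi_mul X a⟩ ∘ ι (Hs (Hs a))).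
    + rewrite (incl_mul a). lhs. rwb (naturality m (ι a)).
      rw (monad_assoc mon a). close.
    + lhs. rwb (naturality ι (xi_mul X a)). unfold R. simpl. flat. reflexivity.
  - simpl. lhs. rw (xi_incl_proj X (Hs a)). rw (xibar_e B (Hs a)).
    rwb (naturality e (ι a)). rw (monad_unitl mon a). rw (xi_proj_incl X a).
    close.
  - transitivity (q a ∘ m a ∘ ⟨ι a⟩ ∘ (ι (Hs a) ∘ fmap Hs (q a ∘ e a)));
      [simpl; flat; reflexivity |].
    rewrite (naturality ι (q a ∘ e a)). lhs.
    rw (f_equal (fmap H) (xi_incl_proj X a)).
    rw (f_equal (fmap H) (xibar_e B a)). rw (monad_unitr mon a).
    rw (xi_proj_incl X a). close.
Qed.

Context (S : NatTrans H H) (S_antipode : IsWeakAntipode (B := B) S).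
Context (sp : forall M, Splitting (coinvariant_projection S M)).
Local Notation P := (adj_monad (right_adjunction S_antipode sp)).
Local Notation i' a := (split_incl (sp (K_obj B a))).
Local Notation q' a := (split_proj (sp (K_obj B a))).

Lemma xi_to_coinvariants_natural a b (f : Hom a b) :
  (q' b ∘ ι b) ∘ fmap Hs f = fmap P f ∘ (q' a ∘ ι a).
Proof.
  simpl. lhs. rw (naturality ι f). unfold R; clear R. rhs.
  rw (incl_proj_free S_antipode sp a). rw (xibar_incl X a). close.
Qed.

Lemma coinvariants_to_xi_natural a b (f : Hom a b) :
  (q b ∘ i' b) ∘ fmap P f = fmap Hs f ∘ (q a ∘ i' a).
Proof.
  simpl. lhs. rw (incl_proj_free S_antipode sp b). rw (xi_proj_xibar X b).
  rw (naturality q f). close.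
Qed.

Definition xi_to_coinvariants : NatTrans Hs P :=
  Build_NatTrans (F := Hs) (G := P)
    (component := fun a => q' a ∘ ι a) xi_to_coinvariants_natural.

Definition coinvariants_to_xi : NatTrans P Hs :=
  Build_NatTrans (F := P) (G := Hs)
    (component := fun a => q a ∘ i' a) coinvariants_to_xi_natural.

(** The coinvariant projection of a free bimodule is [xibar]. The monad of the right adjunction and
    [Hxi] thus come from two splittings of one idempotent, and [q' ι] is an isomorphism of monads;
    monadicity does the rest. *)
Lemma mixed_equivalence : CauchyComplete A ->
  EquivalentCategories (EM (Build_Monad xi_isMonad)) (MixedBimod B).
Proof.
  intros HA.
  assert (Eq : forall a, i' a ∘ q' a = xibar B a)
    by exact (incl_proj_free S_antipode sp).
  assert (Ei : forall a, q' a ∘ i' a = idm _)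
    by (intros a; exact (proj_incl sp (K_obj B a))).
  assert (k_j : forall a, (q a ∘ i' a) ∘ (q' a ∘ ι a) = idm _).
  { intros a. lhs. rw (Eq a). rw (xibar_incl X a). rw (xi_proj_incl X a). close. }
  assert (j_k : forall a, (q' a ∘ ι a) ∘ (q a ∘ i' a) = idm _).
  { intros a. lhs. rw (xi_incl_proj X a). rwb (Eq a). rw (Ei a). rw (Ei a). close. }
  assert (j_unit : forall a, (q' a ∘ ι a) ∘ xi_unit X a = q' a ∘ e a).
  { intros a. simpl. lhs. rw (xi_incl_proj X a). rw (xibar_e B a). close. }
  assert (j_mul : forall a, (q' a ∘ ι a) ∘ xi_mul X a
    = monad_mul P a ∘ fmap P (q' a ∘ ι a) ∘ (q' (Hs a) ∘ ι (Hs a))).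
  { intros a. rewrite <- comp_assoc, incl_mul. simpl. rhs.
    rw (Eq (Hs a)). rw (xibar_incl X (Hs a)).
    rw (incl_proj_free S_antipode sp (split_obj (sp (K_obj B a)))).
    rw (naturality (xibar B) (q' a)). rw (naturality (xibar B) (ι a)).
    rw (xibar_incl X (Hs a)). rw (f_equal (fmap H) (Eq a)).
    rw (f_equal (fmap H) (xibar_incl X a)). close. }
  destruct (right_adjunction_monadic S_antipode sp HA) as [FF ES].
  set (T := Build_Monad xi_isMonad).
  pose proof (@restrict_fully_faithful A P T xi_to_coinvariants
    coinvariants_to_xi j_k j_unit j_mul) as FF'.
  pose proof (restrict_essentially_surjective (P := P) (T := T)
    (j := xi_to_coinvariants) (k := coinvariants_to_xi) k_j j_k j_unit j_mul)
    as ES'.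
  exact (equivalence_sym (equivalence_of_fully_faithful
    (fully_faithful_comp FF' FF) (essentially_surjective_comp ES' ES))).
Qed.
End XiMonad.

Lemma choose_splitting (C : Category) : CauchyComplete C ->
  forall (a : C) (e : Hom a a), e ∘ e = e -> Splitting e.
Proof.
  intros HC a e Ee.
  (* Indefinite description needs an [exists], whereas [CauchyComplete] provides [inhabited]. *)
  assert (E : exists s : Splitting e, True)
    by (destruct (HC a e Ee) as [s]; now exists s).
  exact (proj1_sig (constructive_indefinite_description _ E)).
Qed.

Theorem mainTheorem1 (A : Category) (hA : CauchyComplete A)
  (B : WeakBraidedBimonad A)
  (X : @Splitting (FunCat A A) (wbb_fun B) (xibar B))
  (G : @Splitting (FunCat A A) (compF (wbb_fun B) (wbb_fun B)) (kappa B))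
  (T : @Splitting (FunCat A A) (compF (wbb_fun B) (wbb_fun B)) (kappa' B)) :
  let a := IsWeakBraidedHopfMonad B in
  let b := (exists L : Functor (MixedBimod B) A,
              inhabited (Adjunction L (K_omega B))) /\
           (exists (R : Functor (MixedBimod B) A)
              (adj : Adjunction (K_omega B) R), Monadic adj) in
  let c := (exists R : Functor (MixedBimod B) A,
              inhabited (Adjunction (K_omega B) R)) /\
           (exists (L : Functor (MixedBimod B) A)
              (adj : Adjunction L (K_omega B)), Comonadic adj) in
  let d := GammaIsIso X G in
  let e := GammaPrimeIsIso X T in
  (a <-> b) /\ (a <-> c) /\ (a <-> d) /\ (a <-> e) /\
  (a -> exists law : IsMonad (xi_mul X) (xi_unit X),
          EquivalentCategories (EM (Build_Monad law)) (MixedBimod B)).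
Proof.
  intros a b c d e.
  assert (Hsp : forall S : NatTrans B B, IsWeakAntipode (B := B) S ->
    forall M, Splitting (coinvariant_projection S M)).
  { intros S ES M. apply (choose_splitting hA).
    exact (coinvariant_projection_idem ES M). }
  assert (Ha : RetractsOfFree B -> a).
  { intros HR. apply antipode_of_galois. exact (galois_of_retracts G HR). }
  split; [| split; [| split; [| split]]].
  - split.
    + intros [S ES]. split.
      * exists (coinvariants (Hsp S ES)). constructor.
        exact (left_adjunction ES (Hsp S ES)).
      * exists (coinvariants (Hsp S ES)), (right_adjunction ES (Hsp S ES)).
        destruct (right_adjunction_monadic ES (Hsp S ES) hA) as [FF ES'].
        exact (equivalence_of_fully_faithful FF ES').
    + intros [_ (R & adj & HM)]. exact (Ha (retracts_of_monadic X HM)).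
  - split.
    + intros [S ES]. split.
      * exists (coinvariants (Hsp S ES)). constructor.
        exact (right_adjunction ES (Hsp S ES)).
      * exists (coinvariants (Hsp S ES)), (left_adjunction ES (Hsp S ES)).
        destruct (left_adjunction_comonadic ES (Hsp S ES) hA) as [FF ES'].
        exact (equivalence_of_fully_faithful FF ES').
    + intros [_ (L & adj & HM)]. exact (Ha (retracts_of_comonadic X HM)).
  - split; intros E.
    + apply gamma_iso_of_galois. now apply galois_of_antipode.
    + apply antipode_of_galois. exact (galois_of_gamma_iso E).
  - split; intros E.
    + apply gamma'_iso_of_cogalois, galois_of_antipode.
      exact (proj1 (hopf_op B) E).
    + apply (proj2 (hopf_op B)), antipode_of_galois.
      exact (cogalois_of_gamma'_iso E).
  - intros [S ES]. exists (xi_isMonad X).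
    exact (mixed_equivalence X ES (Hsp S ES) hA).
Qed.
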